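(* Let $\kappa\in\{-1,1\}$, let $\mathcal{H}\in C^1([-1,1])$ and suppose that $S_{\mathcal{H}}$ is a rotationally symmetric $\mathcal{H}$-sphere in $\mathbb{M}^2(\kappa)\times\mathbb{R}$. Then the angle function of $S_{\mathcal{H}}$ is a monotonous function (of the arc-length parameter of the profile curve of $S_{\mathcal{H}}$).
   Context: $\mathbb{M}^2(\kappa)$ is the complete simply connected surface of constant curvature $\kappa$: the hyperbolic plane $\mathbb{H}^2$ if $\kappa=-1$ and the unit sphere $\mathbb{S}^2$ if $\kappa=1$. $\mathbb{M}^2(\kappa)\times\mathbb{R}$ carries the product metric, and $\partial_z$ is the unit vertical Killing field, the gradient of the height function (projection onto $\mathbb{R}$). Given $\mathcal{H}\in C^1([-1,1])$, an immersed oriented surface $\Sigma$ in $\mathbb{M}^2(\kappa)\times\mathbb{R}$ with unit normal $\eta$ is an $\mathcal{H}$-surface if its mean curvature $H_\Sigma$ with respect to $\eta$ (half the sum of the principal curvatures) satisfies $H_\Sigma(p)=\mathcal{H}(\nu(p))$ for all $p\in\Sigma$, where $\nu(p)=\langle\eta_p,\partial_z\rangle$ is the angle function. Sign convention: a vertical graph $z=u$ oriented by its upward unit normal has $2H_\Sigma=\mathrm{div}(\nabla u/\sqrt{1+|\nabla u|^2})$, divergence and gradient being taken in $\mathbb{M}^2(\kappa)$. Standing assumption: the (possible) zeros of $\mathcal{H}$ are isolated and of finite multiplicity. A sphere is a closed (compact, without boundary) immersed surface of genus zero, possibly with self-intersections; an $\mathcal{H}$-sphere is an $\mathcal{H}$-surface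 that is a sphere. It is rotationally symmetric if it is generated by rotating, around a vertical line (the axis), an arc-length parametrized curve (profile curve) $\alpha(s)=(x(s),z(s))$ lying in a vertical plane through the axis, where $x(s)$ is the distance in $\mathbb{M}^2(\kappa)$ to the axis and $z(s)$ is the height. The angle function at the points of the orbit of $\alpha(s)$ is then $\nu=x'(s)$.
   Formalization: For kappa=1, rotational spheres whose profile curve joins the axis to the antipodal vertical line are excluded unless they are slices: their angle function takes the same value at both poles, so it is never monotonous, and such H-spheres exist. *)

(* Defs.v *)
From Stdlib Require Import Reals.
From Coquelicot Require Import Coquelicot.
Open Scope R_scope.

(** ** The ambient space M^2(kappa) x R, for kappa = 1 or kappa = -1

    It is realised in R^4: the first three coordinates describe the unit sphere
    (kappa = 1) or the upper sheet of the hyperboloid in Minkowski 3-space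
    (kappa = -1), the fourth one is the height.  The product metric is the
    restriction of [dot kappa]. *)

Record vec4 := Vec4 { c1 : R; c2 : R; c3 : R; c4 : R }.

Definition dot (kappa : R) (v w : vec4) : R :=
  c1 v * c1 w + c2 v * c2 w + kappa * (c3 v * c3 w) + c4 v * c4 w.

Definition in_space (kappa : R) (p : vec4) : Prop :=
  c1 p * c1 p + c2 p * c2 p + kappa * (c3 p * c3 p) = kappa /\
  (kappa = -1 -> 0 < c3 p).

Definition horizontal_part (p : vec4) : vec4 := Vec4 (c1 p) (c2 p) (c3 p) 0.

Definition tangent_to_space (kappa : R) (p w : vec4) : Prop :=
  dot kappa (horizontal_part p) w = 0.

Definition dz : vec4 := Vec4 0 0 0 1.

(** ** Oriented immersed surfaces in local parametrizations

    [X : R -> R -> vec4] is a parametrization defined on the open set [D] and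
    [N] is the unit normal along it. *)

Definition map2 (F : (R -> R -> R) -> R -> R -> R) (X : R -> R -> vec4)
    (u v : R) : vec4 :=
  Vec4 (F (fun a b => c1 (X a b)) u v) (F (fun a b => c2 (X a b)) u v)
       (F (fun a b => c3 (X a b)) u v) (F (fun a b => c4 (X a b)) u v).

Definition d1 : (R -> R -> vec4) -> R -> R -> vec4 :=
  map2 (fun f u v => Derive (fun a => f a v) u).
Definition d2 : (R -> R -> vec4) -> R -> R -> vec4 :=
  map2 (fun f u v => Derive (fun b => f u b) v).

(** Class C^n at a point, coordinate by coordinate; [Cn_at 0] is continuity. *)
Definition Cn_at (n : nat) (X : R -> R -> vec4) (u v : R) : Prop :=
  ex_diff_n (fun a b => c1 (X a b)) n u v /\
  ex_diff_n (fun a b => c2 (X a b)) n u v /\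
  ex_diff_n (fun a b => c3 (X a b)) n u v /\
  ex_diff_n (fun a b => c4 (X a b)) n u v.

Definition comb (a b : R) (v w : vec4) : vec4 :=
  Vec4 (a * c1 v + b * c1 w) (a * c2 v + b * c2 w)
       (a * c3 v + b * c3 w) (a * c4 v + b * c4 w).

Definition lin_indep (v w : vec4) : Prop :=
  forall a b, comb a b v w = Vec4 0 0 0 0 -> a = 0 /\ b = 0.

Record oriented_immersion (kappa : R) (D : R -> R -> Prop)
    (X N : R -> R -> vec4) : Prop := {
  imm_C2 : forall u v, D u v -> Cn_at 2 X u v;
  imm_in_space : forall u v, D u v -> in_space kappa (X u v);
  imm_immersed : forall u v, D u v -> lin_indep (d1 X u v) (d2 X u v);
  nrm_cont : forall u v, D u v -> Cn_at 0 N u v;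
  nrm_tangent : forall u v, D u v -> tangent_to_space kappa (X u v) (N u v);
  nrm_unit : forall u v, D u v -> dot kappa (N u v) (N u v) = 1;
  nrm_orth1 : forall u v, D u v -> dot kappa (N u v) (d1 X u v) = 0;
  nrm_orth2 : forall u v, D u v -> dot kappa (N u v) (d2 X u v) = 0
}.

(** The principal curvatures are the eigenvalues, with multiplicity, of the
    second fundamental form II relative to the first one I, that is, the roots
    of det (II - lam I).  Since [N] is tangent to M^2(kappa) x R, II is given by
    the ambient second derivatives: II(X_i, X_j) = <X_ij, N>.  With this sign,
    the graph of a convex function has positive curvatures with respect to its
    upward normal. *)
Definition principal_curvatures (kappa : R) (X N : R -> R -> vec4)
    (u v k1 k2 : R) : Prop :=
  let E := dot kappa (d1 X u v) (d1 X u v) in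
  let F := dot kappa (d1 X u v) (d2 X u v) in
  let G := dot kappa (d2 X u v) (d2 X u v) in
  let e := dot kappa (d1 (d1 X) u v) (N u v) in
  let f := dot kappa (d1 (d2 X) u v) (N u v) in
  let g := dot kappa (d2 (d2 X) u v) (N u v) in
  forall lam : R,
    (e - lam * E) * (g - lam * G) - (f - lam * F) * (f - lam * F)
    = (E * G - F * F) * ((lam - k1) * (lam - k2)).

Definition mean_curvature (kappa : R) (X N : R -> R -> vec4) (u v h : R) : Prop :=
  exists k1 k2 : R,
    principal_curvatures kappa X N u v k1 k2 /\ h = (k1 + k2) / 2.

Definition angle (kappa : R) (n : vec4) : R := dot kappa n dz.

Definition H_surface (kappa : R) (H : R -> R) (D : R -> R -> Prop)
    (X N : R -> R -> vec4) : Prop :=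
  oriented_immersion kappa D X N /\
  forall u v, D u v -> mean_curvature kappa X N u v (H (angle kappa (N u v))).

(** ** The prescribed function *)

(** C^1 on [[-1,1]]: restriction of a C^1 function on the line. *)
Definition C1_on_pm1 (H : R -> R) : Prop :=
  exists G : R -> R,
    (forall y, -1 <= y <= 1 -> G y = H y) /\
    (forall y, ex_derive G y /\ continuous (Derive G) y).

(** The second clause says that the order of vanishing at [y] is at most [m]. *)
Definition isolated_zeros_of_finite_multiplicity (H : R -> R) : Prop :=
  forall y, -1 <= y <= 1 -> H y = 0 ->
    (exists delta, 0 < delta /\
       forall t, -1 <= t <= 1 -> t <> y -> Rabs (t - y) < delta -> H t <> 0) /\
    (exists (m : nat) (c delta : R), 0 < c /\ 0 < delta /\
       forall t, -1 <= t <= 1 -> Rabs (t - y) < delta ->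
         c * Rabs (t - y) ^ m <= Rabs (H t)).

(** ** Rotationally symmetric spheres *)

Definition sn (kappa x : R) : R := if Rlt_dec 0 kappa then sin x else sinh x.
Definition cn (kappa x : R) : R := if Rlt_dec 0 kappa then cos x else cosh x.

(** Rotation by the angle [t], around the vertical line through (0,0,1,0), of
    the point of the curve at distance [x s] from that line and height [z s]. *)
Definition rotate (kappa : R) (x z : R -> R) (s t : R) : vec4 :=
  Vec4 (sn kappa (x s) * cos t) (sn kappa (x s) * sin t) (cn kappa (x s)) (z s).

(** Distances in the unit sphere are at most PI. *)
Definition off_axis (kappa x : R) : Prop := 0 < x /\ (kappa = 1 -> x < PI).

(** An H-surface parametrized by polar coordinates [(s,t)], [s > 0], closes up
    regularly at [s = 0]: in the Cartesian coordinates
    [(u,v) = (s cos t, s sin t)] it is an H-surface on a disc around the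
    origin, with the same orientation. *)
Definition closes_up (kappa : R) (H : R -> R) (L : R)
    (X N : R -> R -> vec4) : Prop :=
  exists (eps : R) (Y M : R -> R -> vec4),
    0 < eps <= L /\
    H_surface kappa H (fun u v => u * u + v * v < eps * eps) Y M /\
    forall s t, 0 <= s < eps ->
      Y (s * cos t) (s * sin t) = X s t /\ M (s * cos t) (s * sin t) = N s t.

(** The sphere is [0,L] x (circle) with each of the circles [s = 0] and [s = L]
    collapsed to a point (a pole); [(x, z)] is the profile curve.

    [sphere_last_pole]: both poles lie on the axis, i.e. x = 0 there.  If
    kappa = 1 the rotations also fix the line x = PI; a slice S^2 x {const} has
    its second pole on it, and is included.  Non-horizontal curves joining x = 0
    to x = PI are not considered to generate spheres rotated around the axis:
    their angle function takes the same value at both poles, hence is never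
    monotone. *)
Record rotational_H_sphere (kappa : R) (H : R -> R) (L : R) (x z : R -> R)
    (N : R -> R -> vec4) : Prop := {
  sphere_length : 0 < L;
  sphere_arc_length : forall s, 0 < s < L ->
    ex_derive x s /\ ex_derive z s /\ Derive x s ^ 2 + Derive z s ^ 2 = 1;
  sphere_interior : forall s, 0 < s < L -> off_axis kappa (x s);
  sphere_first_pole : x 0 = 0;
  sphere_last_pole :
    x L = 0 \/
    (kappa = 1 /\ x L = PI /\ forall s, 0 <= s <= L -> z s = z 0);
  sphere_H_surface :
    H_surface kappa H (fun s _ => 0 < s < L) (rotate kappa x z) N;
  sphere_cap_first : closes_up kappa H L (rotate kappa x z) N;
  sphere_cap_last :
    closes_up kappa H L (fun s t => rotate kappa x z (L - s) t)
                        (fun s t => N (L - s) t)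
}.

Definition monotone_on (a b : R) (f : R -> R) : Prop :=
  (forall s1 s2, a <= s1 -> s1 <= s2 -> s2 <= b -> f s1 <= f s2) \/
  (forall s1 s2, a <= s1 -> s1 <= s2 -> s2 <= b -> f s2 <= f s1).

(* Main.v *)
From Stdlib Require Import Reals Lra Psatz ClassicalEpsilon.
From Coquelicot Require Import Coquelicot.
Require Import Defs.
Open Scope R_scope.

(** Away from the poles the profile curve, with unit tangent
    [(p, q) = (x', z')], has curvature [k] with [p' = - q k] and [q' = p k].
    The condition on the mean curvature says that [k = 2 G(p) - q ct(x)], where
    [ct = cn / sn] and [G y = sigma H(sigma y)], the sign [sigma] being that of the
    chosen normal ([profile_equation]).  This is an autonomous system for [(x, p, q)], and the
    angle function is [sigma p], so it has to be shown that [p] decreases from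
    its value 1 at the first pole to its value -1 at the last one.  (A slice, the
    only sphere whose last pole is not on the axis, has constant angle function.)

    Two facts about the system carry the proof.

    Along a solution [k' = A k + p q / sn(x)^2] for a continuous function [A].
    If [G 1 > 0], then [q] and [k] are positive near the first pole, and the sign
    of the source term keeps them positive up to the first point [s1] with
    [p = 0], the first equator ([first_arc_exists]).  In particular [p] is
    strictly decreasing there.  The case [G 1 < 0] is its mirror image under
    [z -> - z], and [G 1 = 0] would force a horizontal slice, which never returns
    to the axis ([pole_value_nonzero]).  Moreover [G 1] and [G (-1)] have the
    same sign ([pole_values_same_sign]), so the curve run backwards from the last
    pole is also monotone up to its first equator, the last equator [s2] of the
    curve.

    Solutions of the system are unique, so the phase orbit does not cross
    itself: a crossing would make it periodic, while it comes from the axis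
    ([phase_orbit_injective]).  If [s1 = s2] the two monotone arcs fill the whole
    curve and the proof is complete.  If [s1 < s2], reversing the curve if
    necessary one may assume [x s1 < x s2].  Then the orbit is trapped: whenever
    it enters the half [p > 0] of the phase plane at an equator closer to the
    axis than [x s1], it stays under the first arc, and in the half [p < 0] it
    stays under the last arc ([barrier]).  Hence it only meets equators with
    [x <= x s1] and never reaches [s2] ([no_extra_turn]).

    At the poles, the surface being C^2 in Cartesian coordinates, the height is
    an even C^1 function of the signed distance along a line through the pole, so
    [z' -> 0] ([pole_height]) and then [x' -> 1] at the first pole ([pole_speed]).
    These limits are all that the analysis of the system uses there. *)

(** * Calculus on an interval *)

Lemma continuous_near (f : R -> R) (a e : R) :
  continuous f a -> 0 < e ->
  exists d, 0 < d /\ forall y, Rabs (y - a) < d -> Rabs (f y - f a) < e.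
Proof.
  intros Hf He.
  destruct (proj1 (filterlim_locally f (f a)) Hf (mkposreal e He)) as [d Hd].
  exists d; split; [apply cond_pos | intros y Hy; exact (Hd y Hy)].
Qed.

Lemma continuous_of_derive (f : R -> R) (s l : R) :
  is_derive f s l -> continuous f s.
Proof.
  intros Hf. apply (ex_derive_continuous (V := R_NormedModule)). exists l. exact Hf.
Qed.

Lemma is_derive_eq (f : R -> R) (s l l' : R) :
  is_derive f s l -> l = l' -> is_derive f s l'.
Proof. intros Hf <-. exact Hf. Qed.

Lemma first_zero (f : R -> R) (a b : R) :
  a < b -> (forall s, a <= s <= b -> continuous f s) -> 0 < f a -> f b <= 0 ->
  exists c, a < c <= b /\ f c = 0 /\ forall t, a <= t < c -> 0 < f t.
Proof.
  intros Hab Hf Ha Hb.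
  set (E := fun t => a <= t <= b /\ forall u, a <= u <= t -> 0 < f u).
  assert (HEa : E a).
  { split; [lra | intros u Hu; replace u with a by lra; exact Ha]. }
  destruct (completeness E) as [c [Hub Hlub]].
  { exists b. intros t [Ht _]. lra. }
  { exists a. exact HEa. }
  assert (Hac : a <= c) by (apply Hub; exact HEa).
  assert (Hcb : c <= b) by (apply Hlub; intros t [Ht _]; lra).
  assert (Hlt : forall t, a <= t < c -> 0 < f t).
  { intros t Ht. destruct (Rle_or_lt (f t) 0) as [Hft | Hft]; [exfalso | exact Hft].
    assert (c <= t); [| lra].
    apply Hlub. intros u [Hu HEu].
    destruct (Rle_or_lt u t) as [h | h]; [exact h |].
    specialize (HEu t ltac:(lra)). lra. }
  assert (Hc0 : f c = 0).
  { destruct (Rtotal_order (f c) 0) as [h | [h | h]]; [exfalso | exact h | exfalso].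
    - destruct (continuous_near f c (- f c) (Hf c ltac:(lra)) ltac:(lra)) as [d [Hd Hnear]].
      destruct (Rle_lt_or_eq_dec a c Hac) as [Hac' | Hac']; [| subst c; lra].
      set (t := Rmax a (c - d / 2)).
      assert (Ht : a <= t < c /\ c - d < t).
      { unfold t. apply Rmax_case_strong; intros; lra. }
      specialize (Hlt t ltac:(lra)).
      specialize (Hnear t ltac:(rewrite Rabs_left; lra)).
      apply Rabs_def2 in Hnear. lra.
    - destruct (continuous_near f c (f c) (Hf c ltac:(lra)) h) as [d [Hd Hnear]].
      destruct (Rle_lt_or_eq_dec c b Hcb) as [Hcb' | Hcb']; [| subst c; lra].
      set (t := Rmin b (c + d / 2)).
      assert (Ht : c < t <= b /\ t < c + d).
      { unfold t. apply Rmin_case_strong; intros; lra. }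
      assert (t <= c); [| lra].
      apply Hub. split; [lra |]. intros u Hu.
      destruct (Rlt_or_le u c) as [huc | huc]; [apply Hlt; lra |].
      specialize (Hnear u ltac:(rewrite Rabs_pos_eq; lra)).
      apply Rabs_def2 in Hnear. lra. }
  exists c. split; [| split; [exact Hc0 | exact Hlt]].
  destruct (Rle_lt_or_eq_dec a c Hac) as [h | h]; [lra | subst c; lra].
Qed.

Lemma last_zero (f : R -> R) (a b : R) :
  a < b -> (forall s, a <= s <= b -> continuous f s) -> f a <= 0 -> 0 < f b ->
  exists c, a <= c < b /\ f c = 0 /\ forall t, c < t <= b -> 0 < f t.
Proof.
  intros Hab Hf Ha Hb.
  destruct (first_zero (fun t => f (a + b - t)) a b Hab) as [c [Hc [Hc0 Hlt]]].
  - intros s Hs. apply (continuous_comp (fun t => a + b - t) f).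
    + apply (continuous_of_derive _ _ (-1)). auto_derive; [exact I | ring].
    + apply Hf; lra.
  - replace (a + b - a) with b by ring. exact Hb.
  - replace (a + b - b) with a by ring. exact Ha.
  - exists (a + b - c). split; [lra | split; [exact Hc0 |]].
    intros t Ht. replace t with (a + b - (a + b - t)) by ring. apply Hlt; lra.
Qed.

Lemma constant_sign (f : R -> R) (a b : R) :
  (forall s, a <= s <= b -> continuous f s) ->
  (forall s, a <= s <= b -> f s <> 0) ->
  forall e s, a <= e <= b -> a <= s <= b -> f e < 0 -> f s < 0.
Proof.
  intros Hf Hn e s He Hs Hfe.
  destruct (Rtotal_order (f s) 0) as [h | [h | h]];
    [exact h | exfalso; exact (Hn s Hs h) | exfalso].
  destruct (Rtotal_order e s) as [hes | [hes | hes]]; [ | subst; lra | ].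
  - destruct (last_zero f e s hes) as [c [Hc [Hc0 _]]];
      try lra; [intros; apply Hf; lra | apply (Hn c); lra].
  - destruct (first_zero f s e hes) as [c [Hc [Hc0 _]]];
      try lra; [intros; apply Hf; lra | apply (Hn c); lra].
Qed.

Lemma sign_constant (f : R -> R) (a b : R) :
  (forall y, a < y < b -> continuous f y) ->
  (forall y, a < y < b -> f y = 1 \/ f y = -1) ->
  forall u v, a < u < b -> a < v < b -> f u = f v.
Proof.
  intros Hf Hv.
  assert (key : forall u v, a < u < b -> a < v < b -> f u < 0 -> f v < 0).
  { intros u v Hu Hv'. apply (constant_sign f (Rmin u v) (Rmax u v));
      try (split; first [apply Rmin_l | apply Rmin_r | apply Rmax_l | apply Rmax_r]).
    - intros y Hy. apply Hf. revert Hy.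
      apply Rmin_case; apply Rmax_case; intros; lra.
    - intros y Hy.
      assert (hy : a < y < b) by (revert Hy; apply Rmin_case; apply Rmax_case; intros; lra).
      destruct (Hv y hy); lra. }
  intros u v Hu Hv'. pose proof (key u v Hu Hv'). pose proof (key v u Hv' Hu).
  destruct (Hv u Hu); destruct (Hv v Hv'); lra.
Qed.

Lemma derive_pos_local (f : R -> R) (c l : R) :
  is_derive f c l -> 0 < l ->
  exists d, 0 < d /\ (forall t, c < t < c + d -> f c < f t) /\
                    (forall t, c - d < t < c -> f t < f c).
Proof.
  intros Hf Hl. apply is_derive_Reals in Hf.
  destruct (Hf l Hl) as [d Hd].
  assert (key : forall t, t <> c -> Rabs (t - c) < d -> 0 < (f t - f c) / (t - c)).
  { intros t Htc Ht. specialize (Hd (t - c) ltac:(lra) Ht).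
    replace (c + (t - c)) with t in Hd by ring.
    apply Rabs_def2 in Hd. lra. }
  exists d. split; [apply cond_pos | split; intros t Ht].
  - specialize (key t ltac:(lra) ltac:(rewrite Rabs_pos_eq; lra)).
    apply (Rmult_lt_compat_r (t - c)) in key; [| lra].
    replace ((f t - f c) / (t - c) * (t - c)) with (f t - f c) in key by (field; lra). lra.
  - specialize (key t ltac:(lra) ltac:(rewrite Rabs_left; lra)).
    apply (Rmult_lt_compat_r (c - t)) in key; [| lra].
    replace ((f t - f c) / (t - c) * (c - t)) with (f c - f t) in key by (field; lra). lra.
Qed.

Lemma derive_neg_local (f : R -> R) (c l : R) :
  is_derive f c l -> l < 0 ->
  exists d, 0 < d /\ (forall t, c < t < c + d -> f t < f c) /\
                    (forall t, c - d < t < c -> f c < f t).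
Proof.
  intros Hf Hl.
  destruct (derive_pos_local (fun t => - f t) c (- l)) as [d [Hd [H1 H2]]]; [ | lra | ].
  - exact (is_derive_opp _ _ _ Hf).
  - exists d. split; [exact Hd | split; intros t Ht].
    + specialize (H1 t Ht). lra.
    + specialize (H2 t Ht). lra.
Qed.

Lemma mean_value (f f' : R -> R) (a b : R) :
  a < b ->
  (forall s, a <= s <= b -> continuous f s) ->
  (forall s, a < s < b -> is_derive f s (f' s)) ->
  exists c, a < c < b /\ f b - f a = f' c * (b - a).
Proof.
  intros Hab Hc Hd.
  assert (pr1 : forall c, a < c < b -> derivable_pt f c).
  { intros c Hcab. exists (f' c). apply is_derive_Reals, Hd, Hcab. }
  assert (pr2 : forall c, a < c < b -> derivable_pt id c).
  { intros c _. apply derivable_pt_id. }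
  destruct (MVT f id a b pr1 pr2 Hab) as [c [P HP]].
  - intros c Hcab. apply continuity_pt_filterlim, Hc, Hcab.
  - intros c _. apply derivable_continuous_pt, derivable_pt_id.
  - exists c. split; [exact P |].
    replace (derive_pt id c (pr2 c P)) with 1 in HP
      by (symmetry; apply derive_pt_eq_0, derivable_pt_lim_id).
    replace (derive_pt f c (pr1 c P)) with (f' c) in HP
      by (symmetry; apply derive_pt_eq_0, is_derive_Reals, Hd, P).
    unfold id in HP. lra.
Qed.

Lemma nondecreasing_of_derive (f f' : R -> R) (a b : R) :
  (forall s, a <= s <= b -> continuous f s) ->
  (forall s, a < s < b -> is_derive f s (f' s)) ->
  (forall s, a < s < b -> 0 <= f' s) ->
  forall s t, a <= s -> s <= t -> t <= b -> f s <= f t.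
Proof.
  intros Hc Hd Hp s t Has Hst Htb.
  destruct (Rle_lt_or_eq_dec s t Hst) as [h | h]; [| subst; lra].
  destruct (mean_value f f' s t h) as [c [Hcst Hfc]];
    [intros; apply Hc; lra | intros; apply Hd; lra |].
  assert (0 <= f' c * (t - s)) by (apply Rmult_le_pos; [apply Hp |]; lra).
  lra.
Qed.

Lemma increasing_of_derive (f f' : R -> R) (a b : R) :
  (forall s, a <= s <= b -> continuous f s) ->
  (forall s, a < s < b -> is_derive f s (f' s)) ->
  (forall s, a < s < b -> 0 < f' s) ->
  forall s t, a <= s -> s < t -> t <= b -> f s < f t.
Proof.
  intros Hc Hd Hp s t Has Hst Htb.
  destruct (mean_value f f' s t Hst) as [c [Hcst Hfc]];
    [intros; apply Hc; lra | intros; apply Hd; lra |].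
  assert (0 < f' c * (t - s)) by (apply Rmult_lt_0_compat; [apply Hp |]; lra).
  lra.
Qed.

Lemma decreasing_of_derive (f f' : R -> R) (a b : R) :
  (forall s, a <= s <= b -> continuous f s) ->
  (forall s, a < s < b -> is_derive f s (f' s)) ->
  (forall s, a < s < b -> f' s < 0) ->
  forall s t, a <= s -> s < t -> t <= b -> f t < f s.
Proof.
  intros Hc Hd Hp s t Has Hst Htb.
  destruct (mean_value f f' s t Hst) as [c [Hcst Hfc]];
    [intros; apply Hc; lra | intros; apply Hd; lra |].
  assert (0 < (- f' c) * (t - s)).
  { specialize (Hp c ltac:(lra)). apply Rmult_lt_0_compat; lra. }
  lra.
Qed.

(** The differential inequality is only required in the interior, because the
    quantities it is applied to need not be differentiable at the poles. *)
Lemma gronwall_zero (w w' : R -> R) (C a b c : R) :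
  a <= c <= b ->
  (forall s, a <= s <= b -> continuous w s) ->
  (forall s, a < s < b -> is_derive w s (w' s)) ->
  (forall s, a < s < b -> Rabs (w' s) <= C * w s) ->
  (forall s, a <= s <= b -> 0 <= w s) ->
  w c = 0 ->
  forall s, a <= s <= b -> w s = 0.
Proof.
  intros Hc Hw Hd HC Hpos Hwc s Hs.
  assert (Hexp : forall m t, is_derive (fun t => exp (m * t)) t (m * exp (m * t))).
  { intros m t. auto_derive; [exact I | ring]. }
  assert (Hg : forall m t, a <= t <= b -> continuous (fun t => w t * exp (m * t)) t).
  { intros m t Ht. apply (continuous_mult w (fun t => exp (m * t)));
      [apply Hw, Ht | exact (continuous_of_derive _ _ _ (Hexp m t))]. }
  assert (Hgd : forall m t, a < t < b ->
            is_derive (fun t => w t * exp (m * t)) t ((w' t + m * w t) * exp (m * t))).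
  { intros m t Ht.
    replace ((w' t + m * w t) * exp (m * t))
      with (plus (mult (w' t) (exp (m * t))) (mult (w t) (m * exp (m * t))))
      by (unfold plus, mult; simpl; ring).
    exact (is_derive_mult w (fun t => exp (m * t)) t _ _ (Hd t Ht) (Hexp m t) Rmult_comm). }
  assert (Hle : w s <= 0); [| specialize (Hpos s Hs); lra].
  destruct (Rle_or_lt s c) as [hsc | hsc].
  - assert (h : w s * exp (C * s) <= w c * exp (C * c)).
    { apply (nondecreasing_of_derive _ _ a b (Hg C) (Hgd C)); try lra.
      intros t Ht. apply Rmult_le_pos; [| left; apply exp_pos].
      specialize (HC t Ht). apply Rabs_le_between in HC. lra. }
    rewrite Hwc, Rmult_0_l in h. pose proof (exp_pos (C * s)). nra.
  - assert (h : - (w c * exp (- C * c)) <= - (w s * exp (- C * s))).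
    { apply (nondecreasing_of_derive (fun t => - (w t * exp (- C * t)))
               (fun t => - ((w' t + - C * w t) * exp (- C * t))) a b); try lra.
      - intros t Ht. apply (continuous_opp (fun t => w t * exp (- C * t))), Hg, Ht.
      - intros t Ht. exact (is_derive_opp _ _ _ (Hgd (- C) t Ht)).
      - intros t Ht. rewrite Ropp_mult_distr_l.
        apply Rmult_le_pos; [| left; apply exp_pos].
        specialize (HC t Ht). apply Rabs_le_between in HC. lra. }
    rewrite Hwc, Rmult_0_l in h. pose proof (exp_pos (- C * s)). nra.
Qed.

Lemma continuous_bounded (f : R -> R) (a b : R) :
  a <= b -> (forall s, a <= s <= b -> continuous f s) ->
  exists K, 0 <= K /\ forall s, a <= s <= b -> Rabs (f s) <= K.
Proof.
  intros Hab Hf.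
  destruct (continuity_ab_maj (fun s => Rabs (f s)) a b Hab) as [M [HM _]].
  - intros c Hc. apply continuity_pt_filterlim.
    apply (continuous_comp f Rabs); [apply Hf, Hc | apply continuous_Rabs].
  - exists (Rabs (f M)). split; [apply Rabs_pos | exact HM].
Qed.

Lemma C1_lipschitz (f f' : R -> R) (a b : R) :
  a <= b -> (forall y, a <= y <= b -> is_derive f y (f' y)) ->
  (forall y, a <= y <= b -> continuous f' y) ->
  exists K, 0 <= K /\ (forall y, a <= y <= b -> Rabs (f' y) <= K) /\
    forall u v, a <= u <= b -> a <= v <= b -> Rabs (f u - f v) <= K * Rabs (u - v).
Proof.
  intros Hab Hd Hc.
  destruct (continuous_bounded f' a b Hab Hc) as [K [HK0 HK]].
  exists K. split; [exact HK0 | split; [exact HK |]]. intros u v Hu Hv.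
  destruct (MVT_gen f v u f') as [c [Hcuv Hfc]].
  - intros y Hy. apply Hd. revert Hy.
    apply Rmin_case; apply Rmax_case; intros; lra.
  - intros y Hy. apply continuity_pt_filterlim.
    apply (continuous_of_derive _ _ (f' y)), Hd. revert Hy.
    apply Rmin_case; apply Rmax_case; intros; lra.
  - rewrite Hfc, Rabs_mult. apply Rmult_le_compat_r; [apply Rabs_pos |].
    apply HK. revert Hcuv. apply Rmin_case; apply Rmax_case; intros; lra.
Qed.

(** The values of [y] outside the range of [f] are clamped to it, which makes the
    inverse globally continuous and avoids one-sided limits at the end points. *)
Lemma continuous_inverse (f : R -> R) (a b : R) :
  a <= b -> (forall s, a <= s <= b -> continuous f s) ->
  (forall s t, a <= s -> s < t -> t <= b -> f t < f s) ->
  exists g : R -> R, (forall y, continuous g y) /\ (forall y, a <= g y <= b) /\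
    forall y, f b <= y <= f a -> f (g y) = y.
Proof.
  intros Hab Hf Hdecr.
  assert (Hfab : f b <= f a).
  { destruct (Rle_lt_or_eq_dec a b Hab) as [h | h]; [| subst; lra].
    left. apply Hdecr; lra. }
  set (cl := fun y => Rmax (f b) (Rmin y (f a))).
  assert (Hcl : forall y, f b <= cl y <= f a).
  { intros y. unfold cl. apply Rmax_case_strong; apply Rmin_case_strong; intros; lra. }
  assert (Hex : forall y, exists t, a <= t <= b /\ f t = cl y).
  { intros y. specialize (Hcl y).
    destruct (Rle_lt_or_eq_dec _ _ (proj1 Hcl)) as [h1 | h1]; [| exists b; lra].
    destruct (Rle_lt_or_eq_dec _ _ (proj2 Hcl)) as [h2 | h2]; [| exists a; lra].
    destruct (first_zero (fun t => f t - cl y) a b) as [c [Hc [Hc0 _]]]; try lra.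
    - destruct (Rle_lt_or_eq_dec a b Hab) as [h | h]; [lra | subst; lra].
    - intros s Hs. apply (continuous_minus f (fun _ => cl y));
        [apply Hf, Hs | apply continuous_const].
    - exists c. lra. }
  set (g := fun y => proj1_sig (constructive_indefinite_description _ (Hex y))).
  assert (Hg : forall y, a <= g y <= b /\ f (g y) = cl y).
  { intros y. exact (proj2_sig (constructive_indefinite_description _ (Hex y))). }
  exists g. split; [| split; [intros y; apply Hg |]].
  - intros y. apply filterlim_locally. intros e.
    pose proof (cond_pos e) as He.
    destruct (Hg y) as [Hgy Hfg].
    assert (H1 : exists d1, 0 < d1 /\ forall y', Rabs (y' - y) < d1 -> g y' < g y + e).
    { destruct (Rle_or_lt (g y + e) b) as [h | h].
      - exists (f (g y) - f (g y + e)).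
        split; [specialize (Hdecr (g y) (g y + e)); lra |].
        intros y' Hy'. destruct (Hg y') as [Hgy' Hfg'].
        destruct (Rlt_or_le (g y') (g y + e)) as [hh | hh]; [exact hh | exfalso].
        assert (f (g y') <= f (g y + e)).
        { destruct (Rle_lt_or_eq_dec _ _ hh) as [h3 | h3]; [left; apply Hdecr; lra |].
          rewrite h3; lra. }
        apply Rabs_def2 in Hy'. rewrite Hfg' in H. rewrite Hfg in Hy'.
        revert Hy' H. unfold cl. pose proof (Hcl y) as h0. unfold cl in h0. revert h0.
        specialize (Hdecr (g y) (g y + e) ltac:(lra) ltac:(lra) h).
        rewrite Hfg in Hdecr. unfold cl in Hdecr. revert Hdecr.
        repeat (apply Rmax_case_strong || apply Rmin_case_strong); intros; lra.
      - exists 1. split; [lra |]. intros y' _. destruct (Hg y'); lra. }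
    assert (H2 : exists d2, 0 < d2 /\ forall y', Rabs (y' - y) < d2 -> g y - e < g y').
    { destruct (Rle_or_lt a (g y - e)) as [h | h].
      - exists (f (g y - e) - f (g y)).
        split; [specialize (Hdecr (g y - e) (g y)); lra |].
        intros y' Hy'. destruct (Hg y') as [Hgy' Hfg'].
        destruct (Rlt_or_le (g y - e) (g y')) as [hh | hh]; [exact hh | exfalso].
        assert (f (g y - e) <= f (g y')).
        { destruct (Rle_lt_or_eq_dec _ _ hh) as [h3 | h3]; [left; apply Hdecr; lra |].
          rewrite h3; lra. }
        apply Rabs_def2 in Hy'. rewrite Hfg' in H. rewrite Hfg in Hy'.
        revert Hy' H. unfold cl. pose proof (Hcl y) as h0. unfold cl in h0. revert h0.
        specialize (Hdecr (g y - e) (g y) h ltac:(lra) ltac:(lra)).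
        rewrite Hfg in Hdecr. unfold cl in Hdecr. revert Hdecr.
        repeat (apply Rmax_case_strong || apply Rmin_case_strong); intros; lra.
      - exists 1. split; [lra |]. intros y' _. destruct (Hg y'); lra. }
    destruct H1 as [d1 [Hd1 H1]]. destruct H2 as [d2 [Hd2 H2]].
    assert (Hd : 0 < Rmin d1 d2) by (apply Rmin_glb_lt; lra).
    exists (mkposreal _ Hd). intros y' Hy'.
    change (Rabs (y' - y) < Rmin d1 d2) in Hy'. change (Rabs (g y' - g y) < e).
    pose proof (Rmin_l d1 d2). pose proof (Rmin_r d1 d2).
    specialize (H1 y' ltac:(lra)). specialize (H2 y' ltac:(lra)).
    apply Rabs_def1; lra.
  - intros y Hy. rewrite (proj2 (Hg y)). unfold cl.
    apply Rmax_case_strong; apply Rmin_case_strong; intros; lra.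
Qed.

(** * The model functions of curvature kappa *)

Definition model (kappa : R) : Prop := kappa = -1 \/ kappa = 1.

Lemma sn_derive kappa x : model kappa -> is_derive (sn kappa) x (cn kappa x).
Proof.
  intros [-> | ->]; unfold sn, cn; destruct (Rlt_dec 0 _); try lra.
  - apply is_derive_Reals, derivable_pt_lim_sinh.
  - apply is_derive_sin.
Qed.

Lemma cn_derive kappa x : model kappa -> is_derive (cn kappa) x (- kappa * sn kappa x).
Proof.
  intros [-> | ->]; unfold sn, cn; destruct (Rlt_dec 0 _); try lra.
  - replace (- -1 * sinh x) with (sinh x) by ring.
    apply is_derive_Reals, derivable_pt_lim_cosh.
  - replace (- (1) * sin x) with (- sin x) by ring. apply is_derive_cos.
Qed.

Lemma cn_sn_square kappa x :
  model kappa -> cn kappa x * cn kappa x + kappa * (sn kappa x * sn kappa x) = 1.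
Proof.
  intros [-> | ->]; unfold sn, cn; destruct (Rlt_dec 0 _); try lra.
  - unfold cosh, sinh. rewrite exp_Ropp. field. apply Rgt_not_eq, exp_pos.
  - pose proof (sin2_cos2 x) as h. unfold Rsqr in h. lra.
Qed.

Lemma sn_0 kappa : model kappa -> sn kappa 0 = 0.
Proof.
  intros [-> | ->]; unfold sn; destruct (Rlt_dec 0 _); try lra.
  - apply sinh_0.
  - apply sin_0.
Qed.

Lemma cn_0 kappa : model kappa -> cn kappa 0 = 1.
Proof.
  intros [-> | ->]; unfold cn; destruct (Rlt_dec 0 _); try lra.
  - apply cosh_0.
  - apply cos_0.
Qed.

Lemma sn_pos kappa x : model kappa -> off_axis kappa x -> 0 < sn kappa x.
Proof.
  intros [-> | ->] [Hx HPI]; unfold sn; destruct (Rlt_dec 0 _); try lra.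
  - rewrite <- sinh_0. apply sinh_lt, Hx.
  - apply sin_gt_0; [exact Hx | apply HPI; reflexivity].
Qed.

Lemma off_axis_between kappa a b x :
  off_axis kappa a -> off_axis kappa b -> a <= x <= b -> off_axis kappa x.
Proof.
  intros [Ha _] [_ Hb] Hx. split; [lra | intros h; specialize (Hb h); lra].
Qed.

Definition ct (kappa x : R) : R := cn kappa x / sn kappa x.

Lemma ct_derive kappa x :
  model kappa -> off_axis kappa x -> is_derive (ct kappa) x (- / (sn kappa x * sn kappa x)).
Proof.
  intros hk Hx. pose proof (sn_pos kappa x hk Hx) as Hs.
  replace (- / (sn kappa x * sn kappa x)) with
    ((- kappa * sn kappa x * sn kappa x - cn kappa x * cn kappa x) / sn kappa x ^ 2).
  - apply (is_derive_div (cn kappa) (sn kappa));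
      [apply cn_derive, hk | apply sn_derive, hk | lra].
  - pose proof (cn_sn_square kappa x hk) as h.
    replace (- kappa * sn kappa x * sn kappa x - cn kappa x * cn kappa x) with (-1) by lra.
    field. lra.
Qed.

Lemma ct_decreasing kappa a b :
  model kappa -> off_axis kappa a -> off_axis kappa b -> a < b -> ct kappa b < ct kappa a.
Proof.
  intros hk Ha Hb Hab.
  apply (decreasing_of_derive (ct kappa) (fun y => - / (sn kappa y * sn kappa y)) a b); try lra.
  - intros s Hs. eapply continuous_of_derive, ct_derive; [exact hk |].
    apply (off_axis_between kappa a b); assumption.
  - intros s Hs. apply ct_derive; [exact hk |].
    apply (off_axis_between kappa a b); try assumption; lra.
  - intros s Hs. assert (0 < sn kappa s).
    { apply sn_pos; [exact hk |]. apply (off_axis_between kappa a b); try assumption; lra. }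
    apply Ropp_lt_gt_0_contravar, Rinv_0_lt_compat, Rmult_lt_0_compat; assumption.
Qed.

(** * The phase system of profile curves *)

(** The curvature of the profile curve as a function of the point of the phase
    space, solved from the prescribed mean curvature equation. *)
Definition curv (kappa : R) (G : R -> R) (x p q : R) : R := 2 * G p - q * ct kappa x.

Record solution (kappa : R) (G : R -> R) (a b : R) (x p q : R -> R) : Prop := {
  sol_x : forall s, a < s < b -> is_derive x s (p s);
  sol_p : forall s, a < s < b -> is_derive p s (- (q s * curv kappa G (x s) (p s) (q s)));
  sol_q : forall s, a < s < b -> is_derive q s (p s * curv kappa G (x s) (p s) (q s));
  sol_circle : forall s, a < s < b -> p s * p s + q s * q s = 1;
  sol_off : forall s, a < s < b -> off_axis kappa (x s)
}.
Arguments sol_x {kappa G a b x p q}.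
Arguments sol_p {kappa G a b x p q}.
Arguments sol_q {kappa G a b x p q}.
Arguments sol_circle {kappa G a b x p q}.
Arguments sol_off {kappa G a b x p q}.

Definition class_C1 (G : R -> R) : Prop :=
  forall y, ex_derive G y /\ continuous (Derive G) y.

Lemma C1_opp G : class_C1 G -> class_C1 (fun y => - G y).
Proof.
  intros hG y. split.
  - apply (ex_derive_opp G), hG.
  - apply (continuous_ext (fun y => - Derive G y)).
    + intros t. symmetry. apply Derive_opp.
    + apply (continuous_opp (Derive G)), hG.
Qed.

Lemma C1_reflect G : class_C1 G -> class_C1 (fun y => G (- y)).
Proof.
  intros hG.
  assert (Hd : forall y, is_derive (fun y => G (- y)) y (- Derive G (- y))).
  { intros y. replace (- Derive G (- y)) with (scal (-1) (Derive G (- y)))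
      by (unfold scal; simpl; unfold mult; simpl; ring).
    apply (is_derive_comp G Ropp); [apply Derive_correct, hG |].
    auto_derive; [exact I | ring]. }
  intros y. split; [eexists; apply Hd |].
  apply (continuous_ext (fun y => - Derive G (- y))).
  - intros t. symmetry. apply is_derive_unique, Hd.
  - apply (continuous_opp (fun y => Derive G (- y))).
    apply (continuous_comp Ropp (Derive G)); [| apply hG].
    apply (continuous_of_derive Ropp y (-1)). auto_derive; [exact I | ring].
Qed.

Lemma C1_lipschitz_unit G : class_C1 G ->
  exists K, 0 <= K /\ (forall y, -1 <= y <= 1 -> Rabs (Derive G y) <= K) /\
    forall u v, -1 <= u <= 1 -> -1 <= v <= 1 -> Rabs (G u - G v) <= K * Rabs (u - v).
Proof.
  intros hG. apply C1_lipschitz; [lra | |]; intros y _; [apply Derive_correct |]; apply hG.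
Qed.

Lemma off_axis_range kappa (x : R -> R) a b :
  a <= b -> (forall s, a <= s <= b -> continuous x s) ->
  (forall s, a <= s <= b -> off_axis kappa (x s)) ->
  exists m M, off_axis kappa m /\ off_axis kappa M /\
    forall s, a <= s <= b -> m <= x s <= M.
Proof.
  intros Hab Hc Ho.
  destruct (continuity_ab_maj x a b Hab) as [M [HM HMab]].
  { intros c Hcab. apply continuity_pt_filterlim, Hc, Hcab. }
  destruct (continuity_ab_min x a b Hab) as [m [Hm Hmab]].
  { intros c Hcab. apply continuity_pt_filterlim, Hc, Hcab. }
  exists (x m), (x M). split; [apply Ho, Hmab | split; [apply Ho, HMab |]].
  intros s Hs. split; [apply Hm, Hs | apply HM, Hs].
Qed.

Lemma ct_lipschitz kappa m M :
  model kappa -> off_axis kappa m -> off_axis kappa M -> m <= M ->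
  exists K B, 0 <= K /\ 0 <= B /\
    (forall u, m <= u <= M -> Rabs (ct kappa u) <= B) /\
    (forall u v, m <= u <= M -> m <= v <= M ->
       Rabs (ct kappa u - ct kappa v) <= K * Rabs (u - v)).
Proof.
  intros hk Hm HM HmM.
  assert (Ho : forall y, m <= y <= M -> off_axis kappa y).
  { intros y. apply off_axis_between; assumption. }
  destruct (C1_lipschitz (ct kappa) (fun y => - / (sn kappa y * sn kappa y)) m M HmM)
    as [K [HK [_ HKl]]].
  - intros y Hy. apply ct_derive; [exact hk | apply Ho, Hy].
  - intros y Hy. pose proof (sn_pos kappa y hk (Ho y Hy)).
    assert (Hs : continuous (sn kappa) y) by (eapply continuous_of_derive, sn_derive, hk).
    apply (continuous_opp (fun y => / (sn kappa y * sn kappa y))).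
    apply (continuous_Rinv_comp (fun y => sn kappa y * sn kappa y)); [| nra].
    apply (continuous_mult (sn kappa) (sn kappa)); exact Hs.
  - destruct (continuous_bounded (ct kappa) m M HmM) as [B [HB0 HB]].
    { intros s Hs. eapply continuous_of_derive, ct_derive; [exact hk | apply Ho, Hs]. }
    exists K, B. auto.
Qed.

Lemma solution_continuous kappa G a b x p q :
  solution kappa G a b x p q -> forall s, a < s < b ->
  continuous x s /\ continuous p s /\ continuous q s.
Proof.
  intros S s Hs. split; [| split]; eapply continuous_of_derive.
  - apply (sol_x S s Hs).
  - apply (sol_p S s Hs).
  - apply (sol_q S s Hs).
Qed.

Lemma circle_bounds p q : p * p + q * q = 1 -> -1 <= p <= 1 /\ -1 <= q <= 1.
Proof. intros h. split; split; nra. Qed.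

Lemma Rabs_between y : -1 <= y <= 1 -> Rabs y <= 1.
Proof. intros h. apply Rabs_le; lra. Qed.

Lemma Rabs_square y : Rabs y * Rabs y = y * y.
Proof. rewrite <- Rabs_mult. apply Rabs_pos_eq. nra. Qed.

(** Gronwall's lemma applied to the squared distance of the two orbits in the phase
    space.  Both off-axis distances stay in a compact interval on which [ct] is
    Lipschitz, and [G] is Lipschitz on [[-1,1]], so the curvatures differ by at
    most a multiple of the distance. *)
Theorem solution_unique kappa G a b c x1 p1 q1 x2 p2 q2 :
  model kappa -> class_C1 G ->
  solution kappa G a b x1 p1 q1 -> solution kappa G a b x2 p2 q2 ->
  a < c < b -> x1 c = x2 c -> p1 c = p2 c -> q1 c = q2 c ->
  forall s, a < s < b -> x1 s = x2 s /\ p1 s = p2 s /\ q1 s = q2 s.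
Proof.
  intros hk hG S1 S2 Hc Hx Hp Hq s Hs.
  set (d := Rmin c s). set (e := Rmax c s).
  assert (Hde : a < d /\ d <= c <= e /\ d <= s <= e /\ e < b).
  { unfold d, e. apply Rmin_case_strong; apply Rmax_case_strong; intros; lra. }
  clearbody d e.
  destruct (off_axis_range kappa x1 d e) as [m1 [M1 [Hm1 [HM1 Hr1]]]]; [lra | | |].
  { intros t Ht. apply (solution_continuous _ _ _ _ _ _ _ S1). lra. }
  { intros t Ht. apply (sol_off S1). lra. }
  destruct (off_axis_range kappa x2 d e) as [m2 [M2 [Hm2 [HM2 Hr2]]]]; [lra | | |].
  { intros t Ht. apply (solution_continuous _ _ _ _ _ _ _ S2). lra. }
  { intros t Ht. apply (sol_off S2). lra. }
  set (m := Rmin m1 m2). set (M := Rmax M1 M2).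
  assert (Hm : off_axis kappa m) by (unfold m; apply Rmin_case; assumption).
  assert (HM : off_axis kappa M) by (unfold M; apply Rmax_case; assumption).
  assert (Hr : forall t, d <= t <= e -> m <= x1 t <= M /\ m <= x2 t <= M).
  { intros t Ht. specialize (Hr1 t Ht). specialize (Hr2 t Ht).
    pose proof (Rmin_l m1 m2). pose proof (Rmin_r m1 m2).
    pose proof (Rmax_l M1 M2). pose proof (Rmax_r M1 M2). unfold m, M. lra. }
  clearbody m M. clear Hr1 Hr2.
  destruct (ct_lipschitz kappa m M hk Hm HM) as [Kc [B [HKc [HB [HBb HKl]]]]].
  { specialize (Hr c ltac:(lra)). lra. }
  destruct (C1_lipschitz_unit G hG) as [K [HK [_ HGl]]].
  set (w := fun t => (x1 t - x2 t) * (x1 t - x2 t) + (p1 t - p2 t) * (p1 t - p2 t)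
                     + (q1 t - q2 t) * (q1 t - q2 t)).
  set (dk := fun t => curv kappa G (x1 t) (p1 t) (q1 t) - curv kappa G (x2 t) (p2 t) (q2 t)).
  set (w' := fun t => 2 * ((x1 t - x2 t) * (p1 t - p2 t)
           + ((q1 t - q2 t) * p2 t - (p1 t - p2 t) * q2 t) * dk t)).
  assert (Hwd : forall t, d <= t <= e -> is_derive w t (w' t)).
  { intros t Ht. assert (Ht' : a < t < b) by lra.
    pose proof (is_derive_minus _ _ _ _ _ (sol_x S1 t Ht') (sol_x S2 t Ht')) as dx.
    pose proof (is_derive_minus _ _ _ _ _ (sol_p S1 t Ht') (sol_p S2 t Ht')) as dp.
    pose proof (is_derive_minus _ _ _ _ _ (sol_q S1 t Ht') (sol_q S2 t Ht')) as dq.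
    pose proof (is_derive_plus _ _ _ _ _ (is_derive_plus _ _ _ _ _
      (is_derive_mult _ _ _ _ _ dx dx Rmult_comm)
      (is_derive_mult _ _ _ _ _ dp dp Rmult_comm))
      (is_derive_mult _ _ _ _ _ dq dq Rmult_comm)) as dw.
    unfold w, w', dk. revert dw. unfold minus, plus, opp, mult; simpl. intros dw.
    apply (is_derive_eq _ _ _ _ dw). ring. }
  assert (Hw0 : w s = 0).
  { apply (gronwall_zero w w' (1 + 6 * (2 * K + B + Kc)) d e c); try lra.
    - intros t Ht. eapply continuous_of_derive, Hwd, Ht.
    - intros t Ht. apply Hwd; lra.
    - intros t Ht. assert (Ht' : a < t < b) by lra.
      destruct (Hr t ltac:(lra)) as [h1 h2].
      destruct (circle_bounds _ _ (sol_circle S1 t Ht')) as [b1 b2].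
      destruct (circle_bounds _ _ (sol_circle S2 t Ht')) as [b3 b4].
      specialize (HKl _ _ h1 h2). specialize (HGl _ _ b1 b3). specialize (HBb _ h1).
      apply Rabs_between in b3. apply Rabs_between in b4.
      assert (Hdk : Rabs (dk t) <= (2 * K + B + Kc) *
                (Rabs (x1 t - x2 t) + Rabs (p1 t - p2 t) + Rabs (q1 t - q2 t))).
      { replace (dk t) with (2 * (G (p1 t) - G (p2 t)) + (- ((q1 t - q2 t) * ct kappa (x1 t))
            + - (q2 t * (ct kappa (x1 t) - ct kappa (x2 t)))))
          by (unfold dk, curv; ring).
        eapply Rle_trans; [apply Rabs_triang |].
        eapply Rle_trans; [apply Rplus_le_compat_l, Rabs_triang |].
        rewrite !Rabs_Ropp, !Rabs_mult, (Rabs_pos_eq 2) by lra.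
        pose proof (Rabs_pos (x1 t - x2 t)). pose proof (Rabs_pos (p1 t - p2 t)).
        pose proof (Rabs_pos (q1 t - q2 t)). pose proof (Rabs_pos (q2 t)).
        pose proof (Rabs_pos (ct kappa (x1 t) - ct kappa (x2 t))).
        assert (Rabs (q1 t - q2 t) * Rabs (ct kappa (x1 t)) <= Rabs (q1 t - q2 t) * B)
          by (apply Rmult_le_compat_l; assumption).
        assert (Rabs (q2 t) * Rabs (ct kappa (x1 t) - ct kappa (x2 t))
                <= 1 * (Kc * Rabs (x1 t - x2 t)))
          by (apply Rmult_le_compat; assumption).
        nra. }
      set (X := Rabs (x1 t - x2 t)) in *. set (P := Rabs (p1 t - p2 t)) in *.
      set (Q := Rabs (q1 t - q2 t)) in *. set (T := 2 * K + B + Kc) in *.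
      assert (HX : 0 <= X) by apply Rabs_pos. assert (HP : 0 <= P) by apply Rabs_pos.
      assert (HQ : 0 <= Q) by apply Rabs_pos. assert (HT : 0 <= T) by (unfold T; lra).
      replace (w t) with (X * X + P * P + Q * Q)
        by (unfold w, X, P, Q; rewrite !Rabs_square; reflexivity).
      unfold w'. rewrite Rabs_mult, (Rabs_pos_eq 2) by lra.
      assert (Hin : Rabs ((q1 t - q2 t) * p2 t - (p1 t - p2 t) * q2 t) <= Q + P).
      { eapply Rle_trans; [apply Rabs_triang |]. rewrite Rabs_Ropp, !Rabs_mult.
        fold P Q. apply Rplus_le_compat; nra. }
      assert (Hprod : Rabs ((x1 t - x2 t) * (p1 t - p2 t)
           + ((q1 t - q2 t) * p2 t - (p1 t - p2 t) * q2 t) * dk t)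
           <= X * P + (Q + P) * (T * (X + P + Q))).
      { eapply Rle_trans; [apply Rabs_triang |]. rewrite (Rabs_mult (x1 t - x2 t)).
        fold X P. apply Rplus_le_compat_l. rewrite Rabs_mult.
        apply Rmult_le_compat; try apply Rabs_pos; assumption. }
      assert (h3 : (Q + P) * (X + P + Q) <= 3 * (X * X + P * P + Q * Q)).
      { pose proof (pow2_ge_0 (X - P)). pose proof (pow2_ge_0 (X - Q)).
        pose proof (pow2_ge_0 (P - Q)). nra. }
      assert (h4 : T * ((Q + P) * (X + P + Q)) <= T * (3 * (X * X + P * P + Q * Q)))
        by (apply Rmult_le_compat_l; assumption).
      pose proof (pow2_ge_0 (X - P)). nra.
    - intros t _. unfold w. repeat apply Rplus_le_le_0_compat; apply Rle_0_sqr.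
    - unfold w. rewrite Hx, Hp, Hq. ring. }
  unfold w in Hw0.
  pose proof (Rle_0_sqr (x1 s - x2 s)) as hx. pose proof (Rle_0_sqr (p1 s - p2 s)) as hp.
  pose proof (Rle_0_sqr (q1 s - q2 s)) as hq. unfold Rsqr in hx, hp, hq.
  split; [| split]; apply Rminus_diag_uniq, Rsqr_0_uniq; unfold Rsqr; lra.
Qed.

Lemma is_derive_shift (f : R -> R) (h s l : R) :
  is_derive f (s + h) l -> is_derive (fun t => f (t + h)) s l.
Proof.
  intros Hf. replace l with (scal 1 l) by (unfold scal; simpl; unfold mult; simpl; ring).
  apply (is_derive_comp f (fun t => t + h)); [exact Hf |].
  auto_derive; [exact I | ring].
Qed.

Lemma is_derive_reverse (f : R -> R) (h s l : R) :
  is_derive f (h - s) l -> is_derive (fun t => f (h - t)) s (- l).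
Proof.
  intros Hf. replace (- l) with (scal (-1) l) by (unfold scal; simpl; unfold mult; simpl; ring).
  apply (is_derive_comp f (fun t => h - t)); [exact Hf |].
  auto_derive; [exact I | ring].
Qed.

Lemma continuous_reverse (f : R -> R) (h s : R) :
  continuous f (h - s) -> continuous (fun t => f (h - t)) s.
Proof.
  intros Hf. apply (continuous_comp (fun t => h - t) f); [| exact Hf].
  apply (continuous_minus (fun _ => h) (fun t => t));
    [apply continuous_const | apply continuous_id].
Qed.

Lemma solution_shift kappa G a b h x p q :
  solution kappa G a b x p q ->
  solution kappa G (a - h) (b - h) (fun s => x (s + h)) (fun s => p (s + h)) (fun s => q (s + h)).
Proof.
  intros S. split; intros s Hs; assert (Hs' : a < s + h < b) by lra.
  - apply (is_derive_shift x), (sol_x S _ Hs').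
  - apply (is_derive_shift p), (sol_p S _ Hs').
  - apply (is_derive_shift q), (sol_q S _ Hs').
  - apply (sol_circle S _ Hs').
  - apply (sol_off S _ Hs').
Qed.

Lemma solution_restrict kappa G a b a' b' x p q :
  solution kappa G a b x p q -> a <= a' -> b' <= b -> solution kappa G a' b' x p q.
Proof.
  intros S Ha Hb. split; intros s Hs; assert (Hs' : a < s < b) by lra.
  - apply (sol_x S _ Hs').
  - apply (sol_p S _ Hs').
  - apply (sol_q S _ Hs').
  - apply (sol_circle S _ Hs').
  - apply (sol_off S _ Hs').
Qed.

(** The profile of a sphere, as a solution extended continuously to the poles.  The
    functions are continuous on the whole line so that continuity at the poles
    is not a one-sided notion. *)
Record pole_to_pole (kappa : R) (G : R -> R) (L : R) (x p q : R -> R) : Prop := {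
  pp_length : 0 < L;
  pp_solution : solution kappa G 0 L x p q;
  pp_x : forall s, continuous x s;
  pp_p : forall s, continuous p s;
  pp_q : forall s, continuous q s;
  pp_first : x 0 = 0 /\ p 0 = 1 /\ q 0 = 0;
  pp_last : x L = 0 /\ p L = -1 /\ q L = 0
}.
Arguments pp_length {kappa G L x p q}.
Arguments pp_solution {kappa G L x p q}.
Arguments pp_x {kappa G L x p q}.
Arguments pp_p {kappa G L x p q}.
Arguments pp_q {kappa G L x p q}.
Arguments pp_first {kappa G L x p q}.
Arguments pp_last {kappa G L x p q}.

(** Running through the curve backwards changes the sign of the tangent; the
    reflection [z -> - z] restores the sign of [q], and together they preserve [k]. *)
Lemma pole_to_pole_reverse kappa G L x p q :
  pole_to_pole kappa G L x p q ->
  pole_to_pole kappa (fun y => G (- y)) L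
    (fun s => x (L - s)) (fun s => - p (L - s)) (fun s => q (L - s)).
Proof.
  intros O. pose proof (pp_solution O) as S.
  assert (Hk : forall s, curv kappa (fun y => G (- y)) (x (L - s)) (- p (L - s)) (q (L - s))
                 = curv kappa G (x (L - s)) (p (L - s)) (q (L - s))).
  { intros s. unfold curv. rewrite Ropp_involutive. reflexivity. }
  split.
  - exact (pp_length O).
  - split; intros s Hs; assert (Hs' : 0 < L - s < L) by lra; rewrite ?Hk.
    + apply (is_derive_reverse x), (sol_x S _ Hs').
    + pose proof (is_derive_opp _ _ _ (is_derive_reverse p _ _ _ (sol_p S _ Hs'))) as h.
      unfold opp in h; simpl in h. rewrite !Ropp_involutive in h. exact h.
    + replace (- p (L - s) * curv kappa G (x (L - s)) (p (L - s)) (q (L - s)))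
        with (- (p (L - s) * curv kappa G (x (L - s)) (p (L - s)) (q (L - s)))) by ring.
      apply (is_derive_reverse q), (sol_q S _ Hs').
    + rewrite <- (sol_circle S _ Hs'). ring.
    + apply (sol_off S _ Hs').
  - intros s. apply continuous_reverse, (pp_x O).
  - intros s. apply (continuous_opp (fun s => p (L - s))), continuous_reverse, (pp_p O).
  - intros s. apply continuous_reverse, (pp_q O).
  - replace (L - 0) with L by ring. destruct (pp_last O) as [-> [-> ->]]. lra.
  - replace (L - L) with 0 by ring. destruct (pp_first O) as [-> [-> ->]]. lra.
Qed.

(** The reflection [z -> - z], with the opposite normal. *)
Lemma pole_to_pole_flip kappa G L x p q :
  pole_to_pole kappa G L x p q ->
  pole_to_pole kappa (fun y => - G y) L x p (fun s => - q s).
Proof.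
  intros O. pose proof (pp_solution O) as S.
  assert (Hk : forall s, curv kappa (fun y => - G y) (x s) (p s) (- q s)
                 = - curv kappa G (x s) (p s) (q s)).
  { intros s. unfold curv. ring. }
  split.
  - exact (pp_length O).
  - split; intros s Hs; rewrite ?Hk.
    + apply (sol_x S _ Hs).
    + rewrite Rmult_opp_opp. apply (sol_p S _ Hs).
    + rewrite <- Ropp_mult_distr_r. apply (is_derive_opp q), (sol_q S _ Hs).
    + rewrite <- (sol_circle S _ Hs). ring.
    + apply (sol_off S _ Hs).
  - exact (pp_x O).
  - exact (pp_p O).
  - intros s. apply (continuous_opp q), (pp_q O).
  - destruct (pp_first O) as [-> [-> ->]]. lra.
  - destruct (pp_last O) as [-> [-> ->]]. lra.
Qed.

(** If the orbit passes twice through a point, at [t < s], then [x (r + h) = x r] with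
    [h = s - t] for all times [r] by uniqueness; letting [r] tend to 0
    gives [x h = 0] at the interior time [h]. *)
Lemma phase_orbit_injective kappa G L x p q s t :
  model kappa -> class_C1 G -> pole_to_pole kappa G L x p q ->
  0 < t < s -> s < L -> x s = x t -> p s = p t -> q s = q t -> False.
Proof.
  intros hk hG O Ht Hs Hx Hp Hq.
  set (h := s - t).
  pose proof (pp_solution O) as S.
  assert (Heq : forall r, 0 < r < L - h -> x r = x (r + h)).
  { intros r Hr.
    destruct (solution_unique kappa G 0 (L - h) t x p q
      (fun r => x (r + h)) (fun r => p (r + h)) (fun r => q (r + h))) with (s := r)
      as [h1 _]; try assumption; try (unfold h in *; lra).
    - apply (solution_restrict _ _ 0 L); try (unfold h; lra). exact S.
    - apply (solution_restrict _ _ (0 - h) (L - h)); try (unfold h; lra).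
      apply solution_shift, S.
    - replace (t + h) with s by (unfold h; ring). congruence.
    - replace (t + h) with s by (unfold h; ring). congruence.
    - replace (t + h) with s by (unfold h; ring). congruence. }
  assert (Hh : 0 < x h) by (apply (sol_off S); unfold h; lra).
  destruct (continuous_near (fun r => x (r + h) - x r) 0 (x h)) as [d [Hd Hnear]].
  - apply (continuous_minus (fun r => x (r + h)) x); [| apply (pp_x O)].
    apply (continuous_comp (fun r => r + h) x); [| apply (pp_x O)].
    apply (continuous_plus (fun r => r) (fun _ => h));
      [apply continuous_id | apply continuous_const].
  - exact Hh.
  - set (r := Rmin (d / 2) ((L - h) / 2)).
    assert (Hr : 0 < r < L - h /\ r < d).
    { unfold r. unfold h in *. apply Rmin_case_strong; intros; lra. }
    specialize (Hnear r ltac:(rewrite Rminus_0_r, Rabs_pos_eq; lra)).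
    rewrite (Heq r ltac:(lra)), Rplus_0_l, (proj1 (pp_first O)) in Hnear.
    apply Rabs_def2 in Hnear. lra.
Qed.

(** * Behaviour at the poles *)

(** The flux [q sn(x)] across a parallel is the quantity whose derivative has no
    singular term at the axis. *)
Lemma flux_derive kappa G a b x p q s :
  model kappa -> solution kappa G a b x p q -> a < s < b ->
  is_derive (fun s => q s * sn kappa (x s)) s (2 * G (p s) * p s * sn kappa (x s)).
Proof.
  intros hk S Hs. pose proof (sn_pos kappa _ hk (sol_off S s Hs)) as Hsn.
  pose proof (is_derive_mult _ _ _ _ _ (sol_q S s Hs)
    (is_derive_comp _ _ _ _ _ (sn_derive kappa (x s) hk) (sol_x S s Hs)) Rmult_comm) as h.
  revert h. unfold plus, mult, scal; simpl. unfold mult; simpl. intros h.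
  apply (is_derive_eq _ _ _ _ h). unfold curv, ct. field. lra.
Qed.

Lemma sn_continuous kappa (x : R -> R) s :
  model kappa -> continuous x s -> continuous (fun s => sn kappa (x s)) s.
Proof.
  intros hk Hx. apply (continuous_comp x (sn kappa)); [exact Hx |].
  eapply continuous_of_derive, sn_derive, hk.
Qed.

Lemma cn_continuous kappa (x : R -> R) s :
  model kappa -> continuous x s -> continuous (fun s => cn kappa (x s)) s.
Proof.
  intros hk Hx. apply (continuous_comp x (cn kappa)); [exact Hx |].
  eapply continuous_of_derive, cn_derive, hk.
Qed.

Lemma C1_continuous G y : class_C1 G -> continuous G y.
Proof. intros hG. apply (ex_derive_continuous (V := R_NormedModule)), hG. Qed.

(** The singular term [q ct(x)] tends to [G 1], so that [k] tends to [G 1].  Instead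
    of computing the limit, comparing the flux with [c sn(x)^2] for
    [c = 3/2 G 1] gives [q < c sn(x)], which is enough since [3/2 < 2]. *)
Lemma near_first_pole kappa G L x p q :
  model kappa -> class_C1 G -> pole_to_pole kappa G L x p q -> 0 < G 1 ->
  exists d, 0 < d < L /\
    forall s, 0 < s <= d -> 0 < q s /\ 0 < curv kappa G (x s) (p s) (q s).
Proof.
  intros hk hG O Hg. pose proof (pp_solution O) as S. pose proof (pp_length O) as HL.
  destruct (pp_first O) as [Hx0 [Hp0 Hq0]].
  set (g := G 1) in *.
  destruct (continuous_near (fun s => G (p s)) 0 (g / 10)) as [d1 [Hd1 H1]]; [ | lra | ].
  { apply (continuous_comp p G); [apply (pp_p O) | apply C1_continuous, hG]. }
  destruct (continuous_near p 0 (1 / 10)) as [d2 [Hd2 H2]]; [apply (pp_p O) | lra |].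
  destruct (continuous_near (fun s => cn kappa (x s)) 0 (1 / 10)) as [d3 [Hd3 H3]]; [ | lra | ].
  { apply cn_continuous; [exact hk | apply (pp_x O)]. }
  rewrite Hp0 in H1, H2. rewrite Hx0, cn_0 in H3 by exact hk. fold g in H1.
  set (d := Rmin (Rmin d1 d2) (Rmin d3 L) / 2).
  assert (Hd : 0 < d < L /\ d < d1 /\ d < d2 /\ d < d3).
  { unfold d. repeat apply Rmin_case_strong; intros; lra. }
  clearbody d.
  assert (Hest : forall s, 0 < s <= d ->
    9 / 10 * g < G (p s) < 11 / 10 * g /\ 9 / 10 < p s /\ 9 / 10 < cn kappa (x s) < 11 / 10
    /\ 0 < sn kappa (x s)).
  { intros s Hs.
    specialize (H1 s ltac:(rewrite Rminus_0_r, Rabs_pos_eq; lra)).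
    specialize (H2 s ltac:(rewrite Rminus_0_r, Rabs_pos_eq; lra)).
    specialize (H3 s ltac:(rewrite Rminus_0_r, Rabs_pos_eq; lra)).
    apply Rabs_def2 in H1. apply Rabs_def2 in H2. apply Rabs_def2 in H3.
    assert (0 < sn kappa (x s)) by (apply sn_pos; [exact hk | apply (sol_off S); lra]).
    lra. }
  clear H1 H2 H3.
  assert (HF : forall s, continuous (fun s => q s * sn kappa (x s)) s).
  { intros s. apply (continuous_mult q (fun s => sn kappa (x s)));
      [apply (pp_q O) | apply sn_continuous; [exact hk | apply (pp_x O)]]. }
  exists d. split; [lra |]. intros s Hs.
  assert (Hq : 0 < q s).
  { assert (h : q 0 * sn kappa (x 0) < q s * sn kappa (x s)).
    { apply (increasing_of_derive (fun s => q s * sn kappa (x s))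
               (fun s => 2 * G (p s) * p s * sn kappa (x s)) 0 d); try lra.
      - intros t _. apply HF.
      - intros t Ht. apply (flux_derive kappa G 0 L); try assumption; lra.
      - intros t Ht. specialize (Hest t ltac:(lra)).
        repeat apply Rmult_lt_0_compat; lra. }
    rewrite Hq0, Rmult_0_l in h. specialize (Hest s Hs). nra. }
  split; [exact Hq |].
  set (E := fun s => 3 / 2 * g * (sn kappa (x s) * sn kappa (x s)) - q s * sn kappa (x s)).
  assert (HE : E 0 < E s).
  { apply (increasing_of_derive E
      (fun s => sn kappa (x s) * p s * (3 * g * cn kappa (x s) - 2 * G (p s))) 0 d); try lra.
    - intros t _.
      assert (hsn : continuous (fun s => sn kappa (x s)) t)
        by (apply sn_continuous; [exact hk | apply (pp_x O)]).
      apply (continuous_minus (fun s => 3 / 2 * g * (sn kappa (x s) * sn kappa (x s)))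
               (fun s => q s * sn kappa (x s))); [| apply HF].
      apply (continuous_mult (fun _ => 3 / 2 * g)); [apply continuous_const |].
      apply (continuous_mult (fun s => sn kappa (x s)) (fun s => sn kappa (x s))); exact hsn.
    - intros t Ht. assert (Ht' : 0 < t < L) by lra.
      pose proof (is_derive_comp _ _ _ _ _ (sn_derive kappa (x t) hk) (sol_x S t Ht')) as h1.
      pose proof (is_derive_minus _ _ _ _ _
        (is_derive_scal _ t (3 / 2 * g) _ (is_derive_mult _ _ _ _ _ h1 h1 Rmult_comm))
        (flux_derive kappa G 0 L x p q t hk S Ht')) as h.
      revert h. unfold minus, opp, plus, mult, scal; simpl. unfold mult; simpl. intros h.
      unfold E.
      apply (is_derive_eq _ _ _ _ h). field.
    - intros t Ht. specialize (Hest t ltac:(lra)).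
      apply Rmult_lt_0_compat; [apply Rmult_lt_0_compat; lra |]. nra. }
  unfold E in HE. rewrite Hx0, sn_0, Hq0 in HE by exact hk.
  destruct (Hest s Hs) as [hG1 [hp1 [hc1 hs1]]].
  assert (Hquot : q s / sn kappa (x s) < 3 / 2 * g).
  { apply Rmult_lt_reg_r with (sn kappa (x s)); [exact hs1 |].
    apply Rmult_lt_reg_r with (sn kappa (x s)); [exact hs1 |].
    replace (q s / sn kappa (x s) * sn kappa (x s)) with (q s) by (field; lra). lra. }
  assert (Hquot0 : 0 < q s / sn kappa (x s)) by (apply Rdiv_lt_0_compat; assumption).
  unfold curv, ct.
  replace (q s * (cn kappa (x s) / sn kappa (x s)))
    with (q s / sn kappa (x s) * cn kappa (x s)) by (field; lra).
  nra.
Qed.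

Lemma first_equator kappa G L x p q :
  pole_to_pole kappa G L x p q ->
  exists s1, 0 < s1 < L /\ p s1 = 0 /\ forall s, 0 <= s < s1 -> 0 < p s.
Proof.
  intros O.
  destruct (pp_first O) as [_ [Hp0 _]]. destruct (pp_last O) as [_ [HpL _]].
  destruct (first_zero p 0 L) as [s1 [Hs1 [Hp1 Hpos]]]; try lra.
  - exact (pp_length O).
  - intros s _. apply (pp_p O).
  - exists s1. split; [| split; assumption].
    split; [lra |]. destruct (proj2 Hs1) as [h | h]; [exact h |]. subst s1. lra.
Qed.

(** If [G 1 = 0], then [|G p| <= K (1 - p) <= K q^2] as long as [p >= 0], so the flux
    satisfies a linear differential inequality and vanishes up to the first
    equator.  But there [q] is 1 or -1. *)
Lemma pole_value_nonzero kappa G L x p q :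
  model kappa -> class_C1 G -> pole_to_pole kappa G L x p q -> G 1 <> 0.
Proof.
  intros hk hG O Hg. pose proof (pp_solution O) as S.
  destruct (first_equator _ _ _ _ _ _ O) as [s1 [Hs1 [Hp1 Hpos]]].
  destruct (C1_lipschitz_unit G hG) as [K [HK [_ HGl]]].
  set (F := fun s => q s * sn kappa (x s)).
  assert (HF : forall s, continuous F s).
  { intros s. apply (continuous_mult q (fun s => sn kappa (x s)));
      [apply (pp_q O) | apply sn_continuous; [exact hk | apply (pp_x O)]]. }
  set (w' := fun s => 2 * (F s * (2 * G (p s) * p s * sn kappa (x s)))).
  assert (Hw : F s1 * F s1 = 0).
  { apply (gronwall_zero (fun s => F s * F s) w' (4 * K) 0 s1 0); try lra.
    - intros s _. apply (continuous_mult F F); apply HF.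
    - intros s Hs.
      assert (hF : is_derive F s (2 * G (p s) * p s * sn kappa (x s)))
        by (apply (flux_derive kappa G 0 L); try assumption; lra).
      pose proof (is_derive_mult _ _ _ _ _ hF hF Rmult_comm) as h.
      revert h. unfold plus, mult; simpl. intros h. unfold w'.
      apply (is_derive_eq _ _ _ _ h). ring.
    - intros s Hs. assert (Hs' : 0 < s < L) by lra.
      pose proof (sn_pos kappa _ hk (sol_off S s Hs')) as Hsn.
      pose proof (sol_circle S s Hs') as Hcirc.
      destruct (circle_bounds _ _ Hcirc) as [b1 b2].
      pose proof (Hpos s ltac:(lra)) as Hps.
      specialize (HGl (p s) 1 b1 ltac:(lra)). rewrite Hg, Rminus_0_r in HGl.
      rewrite (Rabs_minus_sym (p s)), (Rabs_pos_eq (1 - p s)) in HGl by lra.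
      (* close to p = 1 the circle gives 1 - p <= q^2 *)
      assert (HGq : Rabs (G (p s)) <= K * Rabs (q s)).
      { eapply Rle_trans; [exact HGl |]. apply Rmult_le_compat_l; [exact HK |].
        pose proof (Rabs_pos (q s)). pose proof (Rabs_square (q s)).
        apply Rabs_between in b2. nra. }
      replace (4 * K * (F s * F s)) with (4 * (K * Rabs (q s)) * (sn kappa (x s) * Rabs (F s))).
      2: { replace (F s * F s) with (Rabs (F s) * Rabs (F s)) by apply Rabs_square.
           unfold F at 2. rewrite Rabs_mult, (Rabs_pos_eq (sn kappa (x s))) by lra. ring. }
      replace (w' s) with (4 * G (p s) * (p s * (sn kappa (x s) * F s))) by (unfold w'; ring).
      rewrite !Rabs_mult, (Rabs_pos_eq 4), (Rabs_pos_eq (p s)), (Rabs_pos_eq (sn kappa (x s)))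
        by lra.
      assert (HZ : 0 <= sn kappa (x s) * Rabs (F s))
        by (apply Rmult_le_pos; [lra | apply Rabs_pos]).
      pose proof (Rabs_pos (G (p s))) as HGp.
      set (Z := sn kappa (x s) * Rabs (F s)) in *. clearbody Z.
      apply Rmult_le_compat; try lra; nra.
    - intros s _. apply Rle_0_sqr.
    - unfold F. rewrite (proj2 (proj2 (pp_first O))). ring. }
  assert (HF1 : F s1 = 0) by (apply Rsqr_0_uniq; exact Hw).
  pose proof (sn_pos kappa _ hk (sol_off S s1 Hs1)) as Hsn.
  unfold F in HF1. apply Rmult_integral in HF1.
  pose proof (sol_circle S s1 Hs1) as Hc. rewrite Hp1 in Hc.
  destruct HF1 as [h | h]; [rewrite h in Hc; lra | lra].
Qed.

(** At a zero of [q] one has [q' = 2 p G(p)] with [p] equal to 1 or -1; this is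
    positive under the hypotheses, so [q] cannot decrease to 0. *)
Lemma q_positive kappa G L x p q b :
  model kappa -> class_C1 G -> pole_to_pole kappa G L x p q -> 0 < G 1 ->
  b < L -> (forall s, 0 < s <= b -> p s = -1 -> G (-1) < 0) ->
  forall s, 0 < s <= b -> 0 < q s.
Proof.
  intros hk hG O Hg HbL Hb s Hs.
  destruct (Rlt_or_le 0 (q s)) as [h | h]; [exact h | exfalso].
  pose proof (pp_solution O) as S.
  destruct (near_first_pole _ _ _ _ _ _ hk hG O Hg) as [d [Hd Hnear]].
  destruct (Rle_or_lt s d) as [hsd | hsd]; [destruct (Hnear s); lra |].
  destruct (first_zero q d s hsd) as [c [Hc [Hqc Hpos]]]; try assumption.
  { intros t _. apply (pp_q O). }
  { apply Hnear; lra. }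
  assert (HcL : 0 < c < L) by lra.
  assert (Hl : 0 < p c * curv kappa G (x c) (p c) (q c)).
  { pose proof (sol_circle S c HcL) as Hcirc. unfold curv. rewrite Hqc in *.
    assert (Hpc : p c = 1 \/ p c = -1).
    { assert (hh : (p c - 1) * (p c + 1) = 0) by lra.
      apply Rmult_integral in hh. destruct hh; [left | right]; lra. }
    destruct Hpc as [hp | hp]; [rewrite hp; lra |].
    specialize (Hb c ltac:(lra) hp). rewrite hp. lra. }
  destruct (derive_pos_local q c _ (sol_q S c HcL) Hl) as [e [He [_ Hleft]]].
  set (t := Rmax d (c - e / 2)).
  assert (Ht : d <= t < c /\ c - e < t) by (unfold t; apply Rmax_case_strong; intros; lra).
  specialize (Hleft t ltac:(lra)). specialize (Hpos t ltac:(lra)). lra.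
Qed.

(** If [G (-1)] were negative, [q] could never vanish again after leaving the first
    pole, whereas it would be negative near the last one. *)
Lemma pole_values_same_sign kappa G L x p q :
  model kappa -> class_C1 G -> pole_to_pole kappa G L x p q -> 0 < G 1 -> 0 < G (-1).
Proof.
  intros hk hG O Hg.
  pose proof (pole_to_pole_reverse _ _ _ _ _ _ O) as Or.
  pose proof (C1_reflect G hG) as hGr.
  destruct (Rtotal_order (G (-1)) 0) as [h | [h | h]]; [exfalso | exfalso | exact h].
  - pose proof (pole_to_pole_flip _ _ _ _ _ _ Or) as Of.
    destruct (near_first_pole _ _ _ _ _ _ hk (C1_opp _ hGr) Of) as [d [Hd Hnear]];
      [change (0 < - G (-1)); lra |].
    destruct (Hnear d ltac:(lra)) as [Hq _].
    assert (0 < q (L - d)); [| lra].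
    apply (q_positive kappa G L x p q (L - d)); try assumption; try lra.
    intros; exact h.
  - apply (pole_value_nonzero _ _ _ _ _ _ hk hGr Or). exact h.
Qed.

(** * The arc from a pole to the first equator *)

(** The source term [p q / sn(x)^2] comes from the derivative of [ct], which is the
    same for both signs of kappa. *)
Lemma curv_derive kappa G a b x p q s :
  model kappa -> class_C1 G -> solution kappa G a b x p q -> a < s < b ->
  is_derive (fun s => curv kappa G (x s) (p s) (q s)) s
    ((- 2 * Derive G (p s) * q s - ct kappa (x s) * p s) * curv kappa G (x s) (p s) (q s)
     + p s * q s / (sn kappa (x s) * sn kappa (x s))).
Proof.
  intros hk hG S Hs. pose proof (sn_pos kappa _ hk (sol_off S s Hs)) as Hsn.
  pose proof (is_derive_minus _ _ _ _ _
    (is_derive_scal _ s 2 _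
      (is_derive_comp G p _ _ _ (Derive_correct _ _ (proj1 (hG (p s)))) (sol_p S s Hs)))
    (is_derive_mult _ _ _ _ _ (sol_q S s Hs)
      (is_derive_comp (ct kappa) x _ _ _ (ct_derive kappa (x s) hk (sol_off S s Hs))
         (sol_x S s Hs)) Rmult_comm)) as h.
  revert h. unfold minus, opp, plus, mult, scal; simpl. unfold mult; simpl. intros h.
  apply (is_derive_eq _ _ _ _ h). field. lra.
Qed.

(** The part of the curve between the first pole and the first equator [s1], on
    which the tangent turns monotonically. *)
Record first_arc (kappa : R) (G : R -> R) (L : R) (x p q : R -> R) (s1 : R) : Prop := {
  arc_end : 0 < s1 < L;
  arc_p : p s1 = 0;
  arc_q : q s1 = 1;
  arc_p_pos : forall s, 0 <= s < s1 -> 0 < p s;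
  arc_q_pos : forall s, 0 < s <= s1 -> 0 < q s;
  arc_curv_pos : forall s, 0 < s <= s1 -> 0 < curv kappa G (x s) (p s) (q s)
}.
Arguments arc_end {kappa G L x p q s1}.
Arguments arc_p {kappa G L x p q s1}.
Arguments arc_q {kappa G L x p q s1}.
Arguments arc_p_pos {kappa G L x p q s1}.
Arguments arc_q_pos {kappa G L x p q s1}.
Arguments arc_curv_pos {kappa G L x p q s1}.

(** At a first zero of [k] the linear inequality [k' >= - C k], valid while [p] and
    [q] are positive, would be violated. *)
Lemma first_arc_exists kappa G L x p q :
  model kappa -> class_C1 G -> pole_to_pole kappa G L x p q -> 0 < G 1 ->
  exists s1, first_arc kappa G L x p q s1.
Proof.
  intros hk hG O Hg. pose proof (pp_solution O) as S.
  destruct (first_equator _ _ _ _ _ _ O) as [s1 [Hs1 [Hp1 Hpos]]].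
  assert (Hq : forall s, 0 < s <= s1 -> 0 < q s).
  { apply (q_positive kappa G L x p q s1); try assumption; [lra |].
    intros s Hs Hp. exfalso. destruct (proj2 Hs) as [h | h].
    - specialize (Hpos s ltac:(lra)). lra.
    - subst s. lra. }
  exists s1. split; try assumption.
  - pose proof (sol_circle S s1 Hs1) as Hc. specialize (Hq s1 ltac:(lra)).
    rewrite Hp1 in Hc. nra.
  - intros s Hs. destruct (Rlt_or_le 0 (curv kappa G (x s) (p s) (q s))) as [h | h];
      [exact h | exfalso].
    destruct (near_first_pole _ _ _ _ _ _ hk hG O Hg) as [d [Hd Hnear]].
    destruct (Rle_or_lt s d) as [hsd | hsd]; [destruct (Hnear s); lra |].
    set (k := fun s => curv kappa G (x s) (p s) (q s)).
    assert (Hkc : forall t, 0 < t < L -> continuous k t).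
    { intros t Ht. eapply continuous_of_derive.
      exact (curv_derive kappa G 0 L x p q t hk hG S Ht). }
    destruct (first_zero k d s hsd) as [c [Hc [Hkc0 Hkpos]]].
    { intros t Ht. apply Hkc; lra. }
    { apply Hnear; lra. }
    { exact h. }
    destruct (C1_lipschitz_unit G hG) as [K [HK [HKd _]]].
    destruct (off_axis_range kappa x d c) as [m [M [Hm [HM Hr]]]]; [lra | | |].
    { intros t _. apply (pp_x O). }
    { intros t Ht. apply (sol_off S); lra. }
    destruct (ct_lipschitz kappa m M hk Hm HM) as [_ [B [_ [_ [HB _]]]]].
    { specialize (Hr c ltac:(lra)). lra. }
    set (C := 2 * K + B).
    set (k' := fun t => (- 2 * Derive G (p t) * q t - ct kappa (x t) * p t) * k t
     + p t * q t / (sn kappa (x t) * sn kappa (x t))).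
    assert (Hexp : forall t, is_derive (fun t => exp (C * t)) t (C * exp (C * t))).
    { intros t. auto_derive; [exact I | ring]. }
    (* integrating factor for the linear inequality k' >= - C k *)
    assert (Hmono : k d * exp (C * d) <= k c * exp (C * c)).
    { apply (nondecreasing_of_derive (fun t => k t * exp (C * t))
        (fun t => (k' t + C * k t) * exp (C * t)) d c); try lra.
      - intros t Ht. apply (continuous_mult k (fun t => exp (C * t)));
          [apply Hkc; lra | exact (continuous_of_derive _ _ _ (Hexp t))].
      - intros t Ht. assert (Ht' : 0 < t < L) by lra.
        replace ((k' t + C * k t) * exp (C * t))
          with (plus (mult (k' t) (exp (C * t))) (mult (k t) (C * exp (C * t))))
          by (unfold plus, mult; simpl; ring).
        exact (is_derive_mult k (fun t => exp (C * t)) t _ _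
          (curv_derive kappa G 0 L x p q t hk hG S Ht') (Hexp t) Rmult_comm).
      - intros t Ht. assert (Ht' : 0 < t < L) by lra.
        apply Rmult_le_pos; [| left; apply exp_pos].
        pose proof (sn_pos kappa _ hk (sol_off S t Ht')) as Hsn.
        destruct (circle_bounds _ _ (sol_circle S t Ht')) as [b1 b2].
        specialize (HKd _ b1). specialize (HB _ (Hr t ltac:(lra))).
        specialize (Hkpos t ltac:(lra)).
        assert (Hfrac : 0 <= p t * q t / (sn kappa (x t) * sn kappa (x t))).
        { apply Rmult_le_pos.
          - apply Rmult_le_pos; [left; apply Hpos; lra | left; apply Hq; lra].
          - left. apply Rinv_0_lt_compat, Rmult_lt_0_compat; exact Hsn. }
        assert (HA : Rabs (2 * Derive G (p t) * q t + ct kappa (x t) * p t) <= C).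
        { eapply Rle_trans; [apply Rabs_triang |].
          rewrite !Rabs_mult, (Rabs_pos_eq 2) by lra.
          apply Rabs_between in b1. apply Rabs_between in b2.
          pose proof (Rabs_pos (Derive G (p t))). pose proof (Rabs_pos (ct kappa (x t))).
          pose proof (Rabs_pos (p t)). pose proof (Rabs_pos (q t)).
          unfold C. apply Rplus_le_compat; nra. }
        apply Rabs_le_between in HA. unfold k'.
        assert (0 <= (C - (2 * Derive G (p t) * q t + ct kappa (x t) * p t)) * k t)
          by (apply Rmult_le_pos; lra).
        lra. }
    rewrite Hkc0, Rmult_0_l in Hmono.
    destruct (Hnear d ltac:(lra)) as [_ Hkd]. fold (k d) in Hkd.
    pose proof (exp_pos (C * d)). nra.
Qed.

Lemma continuous_Rmax (f g : R -> R) s :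
  continuous f s -> continuous g s -> continuous (fun t => Rmax (f t) (g t)) s.
Proof.
  intros Hf Hg.
  apply (continuous_ext (fun t => / 2 * (f t + g t + Rabs (f t - g t)))).
  - intros t. apply Rmax_case_strong; intros h;
      [rewrite Rabs_pos_eq by lra | rewrite Rabs_left1 by lra]; lra.
  - apply (continuous_mult (fun _ => / 2)); [apply continuous_const |].
    apply (continuous_plus (fun t => f t + g t) (fun t => Rabs (f t - g t))).
    + apply (continuous_plus f g); assumption.
    + apply (continuous_comp (fun t => f t - g t) Rabs); [| apply continuous_Rabs].
      apply (continuous_minus f g); assumption.
Qed.

Lemma first_arc_decreasing kappa G L x p q s1 :
  pole_to_pole kappa G L x p q -> first_arc kappa G L x p q s1 ->
  forall s t, 0 <= s -> s < t -> t <= s1 -> p t < p s.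
Proof.
  intros O A. pose proof (arc_end A) as Hs1.
  apply (decreasing_of_derive p (fun s => - (q s * curv kappa G (x s) (p s) (q s)))).
  - intros s _. apply (pp_p O).
  - intros s Hs. apply (sol_p (pp_solution O)). lra.
  - intros s Hs. apply Ropp_lt_gt_0_contravar, Rmult_lt_0_compat;
      [apply (arc_q_pos A); lra | apply (arc_curv_pos A); lra].
Qed.

(** * The trapping argument *)

(** Let [a(p)] be the distance to the axis on the first arc as a function of [p].  The
    function [M = max (x - a(p), - q)] cannot vanish on [[c,d]]: where [q = 0] one
    has [p = 1], so [a(p) = 0 < x], and where [x = a(p)] and [q > 0] the orbit
    would meet the first arc.  So [M] keeps the negative sign that it has at [e].
    No order between [e] and [e'] is assumed, so the result can be used forwards
    and, for the reversed curve, backwards. *)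
Lemma barrier kappa G L x p q s1 c d :
  model kappa -> class_C1 G -> pole_to_pole kappa G L x p q -> first_arc kappa G L x p q s1 ->
  s1 < c -> d < L -> (forall s, c <= s <= d -> 0 <= p s) ->
  forall e e', c <= e <= d -> c <= e' <= d ->
  p e = 0 -> q e = 1 -> x e < x s1 -> p e' = 0 -> q e' = 1 /\ x e' < x s1.
Proof.
  intros hk hG O A Hc Hd Hp e e' He He' Hpe Hqe Hxe Hpe'.
  pose proof (pp_solution O) as S. pose proof (arc_end A) as Hs1.
  destruct (pp_first O) as [Hx0 [Hp0 Hq0]].
  pose proof (first_arc_decreasing _ _ _ _ _ _ _ O A) as Hdecr.
  destruct (continuous_inverse p 0 s1) as [tau [Htc [Htr Htp]]];
    [lra | intros; apply (pp_p O) | exact Hdecr |].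
  rewrite (arc_p A), Hp0 in Htp.
  (* the point of the arc at a given level of p is unique *)
  assert (Hinj : forall s, 0 <= s <= s1 -> tau (p s) = s).
  { intros s Hs.
    assert (Hps : 0 <= p s <= 1).
    { split.
      - destruct (Rle_lt_or_eq_dec s s1 (proj2 Hs)) as [h | h];
          [left; apply (arc_p_pos A); lra | rewrite h, (arc_p A); lra].
      - destruct (Rle_lt_or_eq_dec 0 s (proj1 Hs)) as [h | h];
          [rewrite <- Hp0; left; apply Hdecr; lra | rewrite <- h; lra]. }
    pose proof (Htr (p s)) as h1. pose proof (Htp (p s) Hps) as h2.
    destruct (Rtotal_order (tau (p s)) s) as [h | [h | h]]; [ | exact h | ].
    - specialize (Hdecr (tau (p s)) s ltac:(lra) h ltac:(lra)). lra.
    - specialize (Hdecr s (tau (p s)) ltac:(lra) h ltac:(lra)). lra. }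
  set (M := fun s => Rmax (x s - x (tau (p s))) (- q s)).
  assert (Hp1 : forall s, c <= s <= d -> 0 <= p s <= 1).
  { intros s Hs. split; [apply Hp, Hs |].
    apply (circle_bounds _ (q s)), (sol_circle S). lra. }
  assert (Htau0 : tau 0 = s1) by (rewrite <- (arc_p A); apply Hinj; lra).
  assert (HMe : M e < 0).
  { unfold M. rewrite Hpe, Htau0. apply Rmax_lub_lt; lra. }
  assert (HMe' : M e' < 0).
  { apply (constant_sign M c d) with (e := e); try assumption.
    - intros s Hs. apply continuous_Rmax.
      + apply (continuous_minus x (fun s => x (tau (p s)))); [apply (pp_x O) |].
        apply (continuous_comp (fun s => tau (p s)) x); [| apply (pp_x O)].
        apply (continuous_comp p tau); [apply (pp_p O) | apply Htc].
      + apply (continuous_opp q), (pp_q O).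
    - intros s Hs HM0.
      assert (HsL : 0 < s < L) by lra.
      pose proof (sol_circle S s HsL) as Hcirc.
      pose proof (proj1 (sol_off S s HsL)) as Hxs.
      destruct (Hp1 s Hs) as [h0 h1].
      assert (Hle : x s - x (tau (p s)) <= 0 /\ - q s <= 0).
      { rewrite <- HM0. split; [apply Rmax_l | apply Rmax_r]. }
      assert (Hor : x s - x (tau (p s)) = 0 \/ q s = 0).
      { revert HM0. unfold M. apply Rmax_case; intros; [left | right]; lra. }
      set (t := tau (p s)) in *.
      assert (Hpt : p t = p s) by (apply Htp; lra).
      assert (Ht : 0 <= t <= s1) by apply Htr.
      destruct (Rle_lt_or_eq_dec 0 t (proj1 Ht)) as [ht | ht].
      2: { rewrite <- ht in Hle. lra. }
      assert (HtL : 0 < t < L) by lra.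
      pose proof (sol_circle S t HtL) as Hcirct.
      pose proof (arc_q_pos A t ltac:(lra)) as Hqt.
      assert (Hqq : q s = q t).
      { rewrite Hpt in Hcirct. assert (hh : (q s - q t) * (q s + q t) = 0) by lra.
        apply Rmult_integral in hh. destruct hh; lra. }
      destruct Hor as [h | h]; [| lra].
      apply (phase_orbit_injective kappa G L x p q s t hk hG O); lra. }
  pose proof (Rmax_l (x e' - x (tau (p e'))) (- q e')) as h1.
  pose proof (Rmax_r (x e' - x (tau (p e'))) (- q e')) as h2.
  fold (M e') in h1, h2. rewrite Hpe', Htau0 in h1.
  pose proof (sol_circle S e' ltac:(lra)) as Hcirc. rewrite Hpe' in Hcirc.
  split; [nra | lra].
Qed.

(** At an equator with [q = 1] the sign of [k] compares [ct(x)] with [2 G 0], and [ct]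
    is decreasing. *)
Lemma curv_equator kappa G a b :
  model kappa -> off_axis kappa a -> off_axis kappa b ->
  curv kappa G a 0 1 < curv kappa G b 0 1 -> a < b.
Proof.
  intros hk Ha Hb h. unfold curv in h.
  destruct (Rtotal_order a b) as [hab | [hab | hab]]; [exact hab | subst; lra |].
  pose proof (ct_decreasing kappa b a hk Hb Ha hab). lra.
Qed.

(** A point with [p = 0], [q = 1] and [k = 0] is a rest point of the system (a vertical
    cylinder), which a nonconstant orbit cannot reach. *)
Lemma no_equilibrium kappa G L x p q s :
  model kappa -> class_C1 G -> pole_to_pole kappa G L x p q -> 0 < s < L ->
  p s = 0 -> q s = 1 -> curv kappa G (x s) 0 1 <> 0.
Proof.
  intros hk hG O Hs Hp Hq Hk. pose proof (pp_solution O) as S.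
  destruct (first_equator _ _ _ _ _ _ O) as [s1 [Hs1 [_ Hpos]]].
  specialize (Hpos (s1 / 2) ltac:(lra)).
  destruct (solution_unique kappa G 0 L s x p q (fun _ => x s) (fun _ => 0) (fun _ => 1))
    with (s := s1 / 2) as [_ [h _]]; try assumption; try lra.
  split; intros t Ht; rewrite ?Hk, ?Rmult_0_r, ?Ropp_0.
  - apply (is_derive_const (x s) t).
  - apply (is_derive_const 0 t).
  - apply (is_derive_const 1 t).
  - ring.
  - apply (sol_off S), Hs.
Qed.

(** Let [s3] be the last point of [[s1,s2]] with [p = 0], [q = 1] and [x <= x s1], and
    [s4] the next point with [p = 0].  By the barrier of the first arc or of the
    last arc, according to the side on which the orbit leaves [s3], the point
    [s4] has the same properties as [s3], against the choice of [s3].  The barrier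
    of the last arc only gives [q = 1] and [x < x s2] at [s4]; but [p] reaches 0
    from below there, so [k <= 0] and [x < x s1] follows from [curv_equator]. *)
Lemma no_extra_turn kappa G L x p q s1 s2 :
  model kappa -> class_C1 G -> pole_to_pole kappa G L x p q ->
  first_arc kappa G L x p q s1 ->
  first_arc kappa (fun y => G (- y)) L
    (fun s => x (L - s)) (fun s => - p (L - s)) (fun s => q (L - s)) (L - s2) ->
  s1 < s2 -> x s1 < x s2 -> False.
Proof.
  intros hk hG O A1 A2 H12 Hx12.
  pose proof (pp_solution O) as S.
  pose proof (arc_end A1) as Hs1. pose proof (arc_end A2) as Hs2.
  assert (Ep2 : p s2 = 0).
  { pose proof (arc_p A2) as h. cbv beta in h.
    replace (L - (L - s2)) with s2 in h by ring. lra. }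
  assert (Ek2 : 0 < curv kappa G (x s2) 0 1).
  { pose proof (arc_curv_pos A2 (L - s2) ltac:(lra)) as h.
    pose proof (arc_q A2) as hq. cbv beta in h, hq.
    replace (L - (L - s2)) with s2 in h, hq by ring.
    rewrite hq, Ep2 in h. unfold curv in *. rewrite !Ropp_0 in h. exact h. }
  assert (Ek1 : 0 < curv kappa G (x s1) 0 1).
  { pose proof (arc_curv_pos A1 s1 ltac:(lra)) as h.
    rewrite (arc_p A1), (arc_q A1) in h. exact h. }
  set (phi := fun s => Rabs (p s) + (Rabs (q s - 1) + Rmax 0 (x s - x s1))).
  assert (Hphi0 : forall s, phi s <= 0 -> p s = 0 /\ q s = 1 /\ x s <= x s1).
  { intros s Hs. unfold phi in Hs.
    pose proof (Rabs_pos (p s)). pose proof (Rabs_pos (q s - 1)).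
    pose proof (Rmax_l 0 (x s - x s1)). pose proof (Rmax_r 0 (x s - x s1)).
    assert (p s = 0) by (apply Rabs_eq_0; lra).
    assert (q s - 1 = 0) by (apply Rabs_eq_0; lra).
    lra. }
  assert (Hphi1 : forall s, p s = 0 -> q s = 1 -> x s <= x s1 -> phi s = 0).
  { intros s hp hq hx. unfold phi. rewrite hp, hq, Rminus_diag, Rabs_R0, Rmax_left by lra. ring. }
  destruct (last_zero phi s1 s2 H12) as [s3 [Hs3 [Hphi3 Hafter]]].
  { intros s _.
    apply (continuous_plus (fun s => Rabs (p s))
             (fun s => Rabs (q s - 1) + Rmax 0 (x s - x s1))).
    - apply (continuous_comp p Rabs); [apply (pp_p O) | apply continuous_Rabs].
    - apply (continuous_plus (fun s => Rabs (q s - 1)) (fun s => Rmax 0 (x s - x s1))).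
      + apply (continuous_comp (fun s => q s - 1) Rabs); [| apply continuous_Rabs].
        apply (continuous_minus q (fun _ => 1)); [apply (pp_q O) | apply continuous_const].
      + apply continuous_Rmax; [apply continuous_const |].
        apply (continuous_minus x (fun _ => x s1)); [apply (pp_x O) | apply continuous_const]. }
  { rewrite Hphi1; [lra | apply (arc_p A1) | apply (arc_q A1) | lra]. }
  { destruct (Rlt_or_le 0 (phi s2)) as [h | h]; [exact h |].
    apply Hphi0 in h. lra. }
  destruct (Hphi0 s3) as [Ep3 [Eq3 Hx3]]; [lra |].
  assert (Hs3L : 0 < s3 < L) by lra.
  pose proof (sol_p S s3 Hs3L) as Hd3. rewrite Ep3, Eq3, Rmult_1_l in Hd3.
  pose proof (no_equilibrium _ _ _ _ _ _ s3 hk hG O Hs3L Ep3 Eq3) as Hk3.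
  destruct (Rdichotomy _ _ Hk3) as [Hneg | Hpos].
  (* the orbit leaves s3 on the side p > 0 and returns under the first arc *)
  - assert (Hx31 : x s3 < x s1).
    { apply (curv_equator kappa G); [exact hk | apply (sol_off S); lra | apply (sol_off S); lra |].
      lra. }
    assert (H13 : s1 < s3).
    { destruct (Rle_lt_or_eq_dec s1 s3 (proj1 Hs3)) as [h | h]; [exact h | subst; lra]. }
    destruct (derive_pos_local p s3 _ Hd3 ltac:(lra)) as [d [Hd [Hright _]]].
    set (s3' := Rmin (s3 + d / 2) ((s3 + s2) / 2)).
    assert (Hs3' : s3 < s3' < s3 + d /\ s3' < s2)
      by (unfold s3'; apply Rmin_case_strong; intros; lra).
    destruct (first_zero p s3' s2) as [s4 [Hs4 [Ep4 Hbefore]]]; try lra.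
    { intros s _. apply (pp_p O). }
    { rewrite <- Ep3. apply Hright. lra. }
    destruct (barrier kappa G L x p q s1 s3 s4 hk hG O A1 H13) with (e := s3) (e' := s4)
      as [Eq4 Hx4]; try lra.
    { intros s Hs. destruct (Rle_lt_or_eq_dec s3 s (proj1 Hs)) as [h | h]; [| subst; lra].
      destruct (Rle_lt_or_eq_dec s s4 (proj2 Hs)) as [h' | h']; [| subst; lra].
      destruct (Rlt_or_le s s3') as [h'' | h''].
      - rewrite <- Ep3. left. apply Hright. lra.
      - left. apply Hbefore. lra. }
    specialize (Hafter s4 ltac:(lra)). rewrite Hphi1 in Hafter; lra.
  (* the orbit leaves s3 on the side p < 0 and returns under the last arc *)
  - destruct (derive_neg_local p s3 _ Hd3 ltac:(lra)) as [d [Hd [Hright _]]].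
    set (s3' := Rmin (s3 + d / 2) ((s3 + s2) / 2)).
    assert (Hs3' : s3 < s3' < s3 + d /\ s3' < s2)
      by (unfold s3'; apply Rmin_case_strong; intros; lra).
    destruct (first_zero (fun s => - p s) s3' s2) as [s4 [Hs4 [Ep4 Hbefore]]]; try lra.
    { intros s _. apply (continuous_opp p), (pp_p O). }
    { specialize (Hright s3' ltac:(lra)). lra. }
    assert (Hp34 : forall s, s3 < s < s4 -> p s < 0).
    { intros s Hs. destruct (Rlt_or_le s s3') as [h | h].
      - rewrite <- Ep3. apply Hright. lra.
      - specialize (Hbefore s ltac:(lra)). lra. }
    assert (Hs4L : 0 < s4 < L) by lra.
    pose proof (sol_p S s4 Hs4L) as Hd4.
    (* p reaches 0 from below at s4 *)
    assert (Hcross : 0 <= - (q s4 * curv kappa G (x s4) (p s4) (q s4))).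
    { destruct (Rle_or_lt 0 (- (q s4 * curv kappa G (x s4) (p s4) (q s4)))) as [h | h];
        [exact h | exfalso].
      destruct (derive_neg_local p s4 _ Hd4 h) as [d' [Hd' [_ Hleft]]].
      set (t := Rmax (s4 - d' / 2) ((s3 + s4) / 2)).
      assert (Ht : s3 < t < s4 /\ s4 - d' < t)
        by (unfold t; apply Rmax_case_strong; intros; lra).
      specialize (Hleft t ltac:(lra)). specialize (Hp34 t ltac:(lra)). lra. }
    assert (Ep4' : p s4 = 0) by lra. rewrite Ep4' in Hcross.
    assert (H42 : s4 < s2).
    { destruct (Rle_lt_or_eq_dec s4 s2 (proj2 Hs4)) as [h | h]; [exact h | exfalso].
      subst s4. pose proof (arc_q A2) as hq. cbv beta in hq.
      replace (L - (L - s2)) with s2 in hq by ring. rewrite hq in Hcross. lra. }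
    destruct (barrier kappa (fun y => G (- y)) L _ _ _ (L - s2) (L - s4) (L - s3) hk
        (C1_reflect G hG) (pole_to_pole_reverse _ _ _ _ _ _ O) A2)
      with (e := L - s3) (e' := L - s4) as [Eq4 Hx4];
      try lra; cbv beta in *;
      try (replace (L - (L - s4)) with s4 in * by ring);
      try (replace (L - (L - s3)) with s3 in * by ring);
      try (replace (L - (L - s2)) with s2 in * by ring); try lra.
    { intros s Hs. destruct (Req_dec (L - s) s3) as [h | h]; [rewrite h; lra |].
      destruct (Req_dec (L - s) s4) as [h' | h']; [rewrite h'; lra |].
      specialize (Hp34 (L - s) ltac:(lra)). lra. }
    rewrite Eq4 in Hcross.
    assert (Hx41 : x s4 < x s1).
    { apply (curv_equator kappa G); [exact hk | apply (sol_off S); lra | apply (sol_off S); lra |].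
      lra. }
    specialize (Hafter s4 ltac:(lra)). rewrite Hphi1 in Hafter; lra.
Qed.

(** The equators [s1] and [s2] of the arcs starting at the two poles coincide, since
    otherwise the trapping argument applies to the curve or to its reverse. *)
Lemma p_decreasing_of_positive kappa G L x p q :
  model kappa -> class_C1 G -> pole_to_pole kappa G L x p q -> 0 < G 1 ->
  forall s t, 0 <= s -> s <= t -> t <= L -> p t <= p s.
Proof.
  intros hk hG O Hg. pose proof (pp_solution O) as S.
  pose proof (pole_to_pole_reverse _ _ _ _ _ _ O) as Or.
  pose proof (C1_reflect G hG) as hGr.
  destruct (first_arc_exists _ _ _ _ _ _ hk hG O Hg) as [s1 A1].
  destruct (first_arc_exists _ _ _ _ _ _ hk hGr Or) as [r2 A2].
  { exact (pole_values_same_sign _ _ _ _ _ _ hk hG O Hg). }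
  pose proof (arc_end A1) as Hs1. pose proof (arc_end A2) as Hr2.
  assert (Er2 : p (L - r2) = 0) by (pose proof (arc_p A2) as h; cbv beta in h; lra).
  assert (H12 : s1 <= L - r2).
  { destruct (Rle_or_lt s1 (L - r2)) as [h | h]; [exact h |].
    pose proof (arc_p_pos A1 (L - r2) ltac:(lra)). lra. }
  destruct (Rle_lt_or_eq_dec _ _ H12) as [Hlt | Heq].
  - exfalso. set (s2 := L - r2) in *.
    assert (Hr : r2 = L - s2) by (unfold s2; ring).
    rewrite Hr in A2, Hr2. clearbody s2. clear Hr.
    destruct (Rtotal_order (x s1) (x s2)) as [h | [h | h]].
    + exact (no_extra_turn _ _ _ _ _ _ s1 s2 hk hG O A1 A2 Hlt h).
    + apply (phase_orbit_injective kappa G L x p q s2 s1 hk hG O); try lra.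
      * rewrite Er2, (arc_p A1). reflexivity.
      * pose proof (arc_q A2) as hq. cbv beta in hq.
        replace (L - (L - s2)) with s2 in hq by ring. rewrite hq, (arc_q A1). reflexivity.
    + apply (no_extra_turn _ _ _ _ _ _ (L - s2) (L - s1) hk hGr Or A2); try lra.
      * replace (L - (L - s1)) with s1 by ring.
        destruct A1 as [a1 a2 a3 a4 a5 a6].
        split; cbv beta; try assumption;
          try (replace (L - (L - s1)) with s1 by ring); try lra.
        -- intros s Hs. replace (L - (L - s)) with s by ring. rewrite Ropp_involutive. auto.
        -- intros s Hs. replace (L - (L - s)) with s by ring. auto.
        -- intros s Hs. replace (L - (L - s)) with s by ring. unfold curv in *.
           rewrite !Ropp_involutive. auto.
      * cbv beta. replace (L - (L - s1)) with s1 by ring.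
        replace (L - (L - s2)) with s2 by ring. exact h.
  - assert (Hqk : forall s, 0 < s < L -> 0 < q s /\ 0 < curv kappa G (x s) (p s) (q s)).
    { intros s Hs. destruct (Rle_or_lt s s1) as [h | h].
      - split; [apply (arc_q_pos A1) | apply (arc_curv_pos A1)]; lra.
      - pose proof (arc_q_pos A2 (L - s) ltac:(lra)) as hq.
        pose proof (arc_curv_pos A2 (L - s) ltac:(lra)) as hkk. cbv beta in hq, hkk.
        replace (L - (L - s)) with s in hq, hkk by ring. unfold curv in *.
        rewrite Ropp_involutive in hkk. auto. }
    intros s t Hs Hst Ht.
    apply Ropp_le_cancel.
    apply (nondecreasing_of_derive (fun s => - p s)
      (fun s => - (- (q s * curv kappa G (x s) (p s) (q s)))) 0 L); try assumption.
    + intros r _. apply (continuous_opp p), (pp_p O).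
    + intros r Hr. apply (is_derive_opp p), (sol_p S r Hr).
    + intros r Hr. rewrite Ropp_involutive. destruct (Hqk r Hr). nra.
Qed.

Theorem p_decreasing kappa G L x p q :
  model kappa -> class_C1 G -> pole_to_pole kappa G L x p q ->
  forall s t, 0 <= s -> s <= t -> t <= L -> p t <= p s.
Proof.
  intros hk hG O.
  destruct (Rtotal_order (G 1) 0) as [h | [h | h]].
  - apply (p_decreasing_of_positive kappa (fun y => - G y) L x p (fun s => - q s) hk
      (C1_opp G hG) (pole_to_pole_flip _ _ _ _ _ _ O)). lra.
  - exfalso. exact (pole_value_nonzero _ _ _ _ _ _ hk hG O h).
  - exact (p_decreasing_of_positive _ _ _ _ _ _ hk hG O h).
Qed.

(** * One-sided limits and slices *)

Lemma at_right_intro (f : R -> R) (a l : R) :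
  (forall e, 0 < e -> exists d, 0 < d /\ forall s, a < s < a + d -> Rabs (f s - l) < e) ->
  filterlim f (at_right a) (locally l).
Proof.
  intros Hf. apply filterlim_locally. intros e.
  destruct (Hf e (cond_pos e)) as [d [Hd H]].
  exists (mkposreal d Hd). intros s Hs Has. apply (H s).
  change (Rabs (s - a) < d) in Hs. apply Rabs_def2 in Hs. lra.
Qed.

Lemma at_right_elim (f : R -> R) (a l e : R) :
  filterlim f (at_right a) (locally l) -> 0 < e ->
  exists d, 0 < d /\ forall s, a < s < a + d -> Rabs (f s - l) < e.
Proof.
  intros Hf He.
  destruct (proj1 (filterlim_locally f l) Hf (mkposreal e He)) as [d H].
  exists d. split; [apply cond_pos |]. intros s Hs. apply (H s); [| lra].
  change (Rabs (s - a) < d). rewrite Rabs_pos_eq; lra.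
Qed.

Lemma at_left_of_reverse (f : R -> R) (L l : R) :
  filterlim (fun s => f (L - s)) (at_right 0) (locally l) ->
  filterlim f (at_left L) (locally l).
Proof.
  intros Hf. apply filterlim_locally. intros e.
  destruct (at_right_elim _ _ _ _ Hf (cond_pos e)) as [d [Hd H]].
  exists (mkposreal d Hd). intros s Hs HsL.
  change (Rabs (s - L) < d) in Hs. apply Rabs_def2 in Hs.
  specialize (H (L - s) ltac:(lra)).
  assert (E : @eq R (L - (L - s)) s) by ring. rewrite E in H. exact H.
Qed.

Lemma continuity_2d_slice1 (f : R -> R -> R) u v :
  continuity_2d_pt f u v -> continuous (fun a => f a v) u.
Proof.
  intros Hf. apply filterlim_locally. intros e.
  destruct (Hf e) as [d H]. exists d. intros a Ha.
  apply (H a v); [exact Ha |]. rewrite Rminus_diag, Rabs_R0. apply cond_pos.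
Qed.

Lemma continuity_2d_slice2 (f : R -> R -> R) u v :
  continuity_2d_pt f u v -> continuous (fun b => f u b) v.
Proof.
  intros Hf. apply filterlim_locally. intros e.
  destruct (Hf e) as [d H]. exists d. intros b Hb.
  apply (H u b); [| exact Hb]. rewrite Rminus_diag, Rabs_R0. apply cond_pos.
Qed.

Lemma sn_comp_derive kappa (x : R -> R) s l :
  model kappa -> is_derive x s l -> is_derive (fun a => sn kappa (x a)) s (cn kappa (x s) * l).
Proof.
  intros hk Hx. rewrite Rmult_comm.
  exact (is_derive_comp (sn kappa) x s _ _ (sn_derive kappa (x s) hk) Hx).
Qed.

Lemma cn_comp_derive kappa (x : R -> R) s l :
  model kappa -> is_derive x s l ->
  is_derive (fun a => cn kappa (x a)) s (- kappa * sn kappa (x s) * l).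
Proof.
  intros hk Hx. rewrite Rmult_comm.
  exact (is_derive_comp (cn kappa) x s _ _ (cn_derive kappa (x s) hk) Hx).
Qed.

Lemma locally_interval (a b s : R) (P : R -> Prop) :
  a < s < b -> (forall t, a < t < b -> P t) -> locally s P.
Proof.
  intros Hs HP.
  assert (Hd : 0 < Rmin (s - a) (b - s)) by (apply Rmin_glb_lt; lra).
  exists (mkposreal _ Hd). intros t Ht. change (Rabs (t - s) < Rmin (s - a) (b - s)) in Ht.
  apply HP. pose proof (Rmin_l (s - a) (b - s)). pose proof (Rmin_r (s - a) (b - s)).
  apply Rabs_def2 in Ht. lra.
Qed.

Lemma is_derive_scal_r (f : R -> R) s l c :
  is_derive f s l -> is_derive (fun a => f a * c) s (l * c).
Proof.
  intros Hf. apply (is_derive_ext (fun a => c * f a)); [intros a; apply Rmult_comm |].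
  rewrite Rmult_comm. exact (is_derive_scal f s c l Hf).
Qed.

(** * From the surface to the phase system *)

Definition unit_speed (L : R) (x z : R -> R) : Prop :=
  forall s, 0 < s < L -> ex_derive x s /\ ex_derive z s /\ Derive x s ^ 2 + Derive z s ^ 2 = 1.

(** Only [sn(x)] and [cn(x)] are coordinates of the surface; [x'] is recovered from
    their derivatives as [cn (sn x)' - sn (cn x)']. *)
Lemma profile_C2 kappa L x z :
  model kappa -> unit_speed L x z ->
  (forall s t, 0 < s < L -> Cn_at 2 (rotate kappa x z) s t) ->
  forall s, 0 < s < L -> ex_derive (Derive x) s /\ ex_derive (Derive z) s.
Proof.
  intros hk Hu HC s Hs.
  destruct (HC s 0 Hs) as [h1 [_ [h3 h4]]].
  destruct h1 as [_ [_ [_ [[_ [h1 _]] _]]]].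
  destruct h3 as [_ [_ [_ [[_ [h3 _]] _]]]].
  destruct h4 as [_ [_ [_ [[_ [h4 _]] _]]]].
  simpl in h1, h3, h4.
  split; [| exact h4].
  apply (ex_derive_ext_loc (fun a =>
    cn kappa (x a) * Derive (fun a => sn kappa (x a) * cos 0) a
    - sn kappa (x a) * Derive (fun a => cn kappa (x a)) a)).
  - apply (locally_interval 0 L); [exact Hs |]. intros t Ht.
    destruct (Hu t Ht) as [Hx _]. apply Derive_correct in Hx.
    assert (E3 : Derive (fun a => cn kappa (x a)) t = - kappa * sn kappa (x t) * Derive x t)
      by (apply is_derive_unique, cn_comp_derive; assumption).
    assert (E1 : Derive (fun a => sn kappa (x a) * cos 0) t = cn kappa (x t) * Derive x t * cos 0)
      by (apply is_derive_unique, is_derive_scal_r, sn_comp_derive; assumption).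
    rewrite E1, E3, cos_0.
    pose proof (cn_sn_square kappa (x t) hk) as h.
    match goal with |- ?l = ?r => change (@eq R l r) end.
    transitivity ((cn kappa (x t) * cn kappa (x t) + kappa * (sn kappa (x t) * sn kappa (x t)))
      * Derive x t); [ring | rewrite h; ring].
  - destruct (Hu s Hs) as [Hx _]. apply Derive_correct in Hx.
    apply (ex_derive_minus (fun a => cn kappa (x a) * Derive (fun a => sn kappa (x a) * cos 0) a)
      (fun a => sn kappa (x a) * Derive (fun a => cn kappa (x a)) a)).
    + apply (ex_derive_mult (fun a => cn kappa (x a))); [| exact h1].
      eexists. apply cn_comp_derive; [exact hk | exact Hx].
    + apply (ex_derive_mult (fun a => sn kappa (x a))); [| exact h3].
      eexists. apply sn_comp_derive; [exact hk | exact Hx].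
Qed.

Lemma d1_eq F s t : d1 F s t =
  Vec4 (Derive (fun a => c1 (F a t)) s) (Derive (fun a => c2 (F a t)) s)
       (Derive (fun a => c3 (F a t)) s) (Derive (fun a => c4 (F a t)) s).
Proof. reflexivity. Qed.

Lemma d2_eq F s t : d2 F s t =
  Vec4 (Derive (fun b => c1 (F s b)) t) (Derive (fun b => c2 (F s b)) t)
       (Derive (fun b => c3 (F s b)) t) (Derive (fun b => c4 (F s b)) t).
Proof. reflexivity. Qed.

Lemma rotate_d1 kappa x z s t l m :
  model kappa -> is_derive x s l -> is_derive z s m ->
  d1 (rotate kappa x z) s t =
    Vec4 (cn kappa (x s) * l * cos t) (cn kappa (x s) * l * sin t) (- kappa * sn kappa (x s) * l) m.
Proof.
  intros hk Hx Hz. rewrite d1_eq. simpl. f_equal; apply is_derive_unique.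
  - apply is_derive_scal_r, sn_comp_derive; assumption.
  - apply is_derive_scal_r, sn_comp_derive; assumption.
  - apply cn_comp_derive; assumption.
  - exact Hz.
Qed.

Lemma rotate_d2 kappa x z s t :
  d2 (rotate kappa x z) s t = Vec4 (- sn kappa (x s) * sin t) (sn kappa (x s) * cos t) 0 0.
Proof.
  rewrite d2_eq. simpl. f_equal; apply is_derive_unique.
  - auto_derive; [exact I | ring].
  - auto_derive; [exact I | ring].
  - apply (is_derive_const (cn kappa (x s)) t).
  - apply (is_derive_const (z s) t).
Qed.

Lemma rotate_d22 kappa x z s t :
  d2 (d2 (rotate kappa x z)) s t = Vec4 (- sn kappa (x s) * cos t) (- sn kappa (x s) * sin t) 0 0.
Proof.
  rewrite d2_eq. f_equal; apply is_derive_unique.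
  - apply (is_derive_ext (fun b => - sn kappa (x s) * sin b));
      [intros b; rewrite rotate_d2; reflexivity | auto_derive; [exact I | ring]].
  - apply (is_derive_ext (fun b => sn kappa (x s) * cos b));
      [intros b; rewrite rotate_d2; reflexivity | auto_derive; [exact I | ring]].
  - apply (is_derive_ext (fun b => 0));
      [intros b; rewrite rotate_d2; reflexivity | apply (is_derive_const 0 t)].
  - apply (is_derive_ext (fun b => 0));
      [intros b; rewrite rotate_d2; reflexivity | apply (is_derive_const 0 t)].
Qed.

Lemma rotate_d12 kappa x z s t l :
  model kappa -> is_derive x s l ->
  d1 (d2 (rotate kappa x z)) s t =
    Vec4 (- (cn kappa (x s) * l) * sin t) (cn kappa (x s) * l * cos t) 0 0.
Proof.
  intros hk Hx. rewrite d1_eq.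
  f_equal; apply is_derive_unique.
  - apply (is_derive_ext (fun a => - sn kappa (x a) * sin t));
      [intros b; rewrite rotate_d2; reflexivity |].
    apply is_derive_scal_r, (is_derive_opp (fun a => sn kappa (x a))), sn_comp_derive; assumption.
  - apply (is_derive_ext (fun a => sn kappa (x a) * cos t));
      [intros b; rewrite rotate_d2; reflexivity |].
    apply is_derive_scal_r, sn_comp_derive; assumption.
  - apply (is_derive_ext (fun b => 0));
      [intros b; rewrite rotate_d2; reflexivity | apply (is_derive_const 0 s)].
  - apply (is_derive_ext (fun b => 0));
      [intros b; rewrite rotate_d2; reflexivity | apply (is_derive_const 0 s)].
Qed.

Lemma rotate_d11 kappa L x z s t :
  model kappa -> unit_speed L x z -> 0 < s < L ->
  ex_derive (Derive x) s ->
  d1 (d1 (rotate kappa x z)) s t =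
    let S := sn kappa (x s) in let C := cn kappa (x s) in
    let P := Derive x s in let P' := Derive (Derive x) s in
    Vec4 ((C * P' - kappa * S * (P * P)) * cos t) ((C * P' - kappa * S * (P * P)) * sin t)
         (- kappa * (C * (P * P) + S * P')) (Derive (Derive z) s).
Proof.
  intros hk Hu Hs Hx2. cbv zeta.
  destruct (Hu s Hs) as [Hx _]. apply Derive_correct in Hx, Hx2.
  assert (Hloc : forall (g : vec4 -> R), locally s (fun a =>
     g (Vec4 (cn kappa (x a) * Derive x a * cos t) (cn kappa (x a) * Derive x a * sin t)
       (- kappa * sn kappa (x a) * Derive x a) (Derive z a)) = g (d1 (rotate kappa x z) a t))).
  { intros g. apply (locally_interval 0 L); [exact Hs |]. intros a Ha.
    destruct (Hu a Ha) as [Hxa [Hza _]]. apply Derive_correct in Hxa, Hza.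
    rewrite (rotate_d1 kappa x z a t _ _ hk Hxa Hza). reflexivity. }
  pose proof (is_derive_mult _ _ _ _ _ (cn_comp_derive kappa x s _ hk Hx) Hx2 Rmult_comm) as HC.
  pose proof (is_derive_mult _ _ _ _ _ (sn_comp_derive kappa x s _ hk Hx) Hx2 Rmult_comm) as HS.
  revert HC HS. unfold plus, mult; simpl. intros HC HS.
  rewrite d1_eq. f_equal; apply is_derive_unique.
  - apply (is_derive_ext_loc _ _ _ _ (Hloc c1)). simpl.
    apply is_derive_scal_r. apply (is_derive_eq _ _ _ _ HC). ring.
  - apply (is_derive_ext_loc _ _ _ _ (Hloc c2)). simpl.
    apply is_derive_scal_r. apply (is_derive_eq _ _ _ _ HC). ring.
  - apply (is_derive_ext_loc _ _ _ _ (Hloc c3)). simpl.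
    apply (is_derive_ext (fun a => - kappa * (sn kappa (x a) * Derive x a)));
      [intros a; symmetry; apply Rmult_assoc |].
    apply (is_derive_eq _ _ _ _ (is_derive_scal _ s (- kappa) _ HS)).
    unfold scal; simpl; unfold mult; simpl. ring.
Qed.

(** In the basis of the position vector, the two tangent directions of the
    horizontal factor and the vertical direction, the hypotheses leave for [n]
    only a unit vector of the plane of the profile curve orthogonal to the
    tangent, hence one of two opposite vectors, told apart by [sigma]. *)
Lemma normal_form kappa x z s t P Z (n : vec4) :
  model kappa -> 0 < sn kappa (x s) -> P * P + Z * Z = 1 ->
  tangent_to_space kappa (rotate kappa x z s t) n -> dot kappa n n = 1 ->
  dot kappa n (Vec4 (cn kappa (x s) * P * cos t) (cn kappa (x s) * P * sin t)
                    (- kappa * sn kappa (x s) * P) Z) = 0 ->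
  dot kappa n (Vec4 (- sn kappa (x s) * sin t) (sn kappa (x s) * cos t) 0 0) = 0 ->
  let sigma := c4 n * P - (cn kappa (x s) * (c1 n * cos t + c2 n * sin t)
                           - sn kappa (x s) * c3 n) * Z in
  sigma * sigma = 1 /\
  n = Vec4 (- sigma * Z * cn kappa (x s) * cos t) (- sigma * Z * cn kappa (x s) * sin t)
           (kappa * sigma * Z * sn kappa (x s)) (sigma * P).
Proof.
  intros hk HS HPZ. unfold tangent_to_space, rotate, horizontal_part, dot; simpl.
  pose proof (cn_sn_square kappa (x s) hk) as HCS.
  assert (hkk : kappa * kappa = 1) by (destruct hk; subst; ring).
  pose proof (sin2_cos2 t) as Hcs. unfold Rsqr in Hcs.
  destruct n as [n1 n2 n3 n4]; simpl.
  set (S := sn kappa (x s)) in *. set (C := cn kappa (x s)) in *.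
  set (c := cos t) in *. set (si := sin t) in *. clearbody S C c si.
  intros Ht Hu Ho1 Ho2.
  set (r := n1 * c + n2 * si).
  set (al := C * r - S * n3).
  (* no component along the parallels *)
  assert (H12 : n2 * c - n1 * si = 0).
  { assert (h : S * (n2 * c - n1 * si) = 0) by lra.
    apply Rmult_integral in h. destruct h; lra. }
  assert (E1 : n1 = r * c).
  { unfold r. replace n1 with (n1 * (si * si + c * c)) at 1 by (rewrite Hcs; ring).
    replace (n1 * (si * si + c * c)) with
      ((n1 * c + n2 * si) * c - si * (n2 * c - n1 * si)) by ring. rewrite H12. ring. }
  assert (E2 : n2 = r * si).
  { unfold r. replace n2 with (n2 * (si * si + c * c)) at 1 by (rewrite Hcs; ring).
    replace (n2 * (si * si + c * c)) with
      ((n1 * c + n2 * si) * si + c * (n2 * c - n1 * si)) by ring. rewrite H12. ring. }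
  assert (HT : S * r + kappa * (C * n3) = 0) by (unfold r; lra).
  assert (Er : r = C * al).
  { unfold al. replace r with ((C * C + kappa * (S * S)) * r) at 1 by (rewrite HCS; ring).
    replace ((C * C + kappa * (S * S)) * r) with
      (C * (C * r - S * n3) + kappa * S * (S * r + kappa * (C * n3))
       + (1 - kappa * kappa) * (S * C * n3)) by ring.
    rewrite HT, hkk. ring. }
  assert (E3 : n3 = - kappa * S * al).
  { unfold al. replace n3 with ((C * C + kappa * (S * S)) * n3) at 1 by (rewrite HCS; ring).
    replace ((C * C + kappa * (S * S)) * n3) with
      (- kappa * S * (C * r - S * n3) + kappa * C * (S * r + kappa * (C * n3))
       + (1 - kappa * kappa) * (C * C * n3)) by ring.
    rewrite HT, hkk. ring. }
  clearbody al. clearbody r.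
  assert (HU : al * al + n4 * n4 = 1).
  { rewrite <- Hu, E1, E2, E3, Er.
    transitivity (al * al * (C * C * (si * si + c * c) + kappa * (S * S) * (kappa * kappa))
                  + n4 * n4); [| ring].
    rewrite hkk, Hcs, !Rmult_1_r, HCS. ring. }
  assert (HO : al * P + n4 * Z = 0).
  { rewrite <- Ho1, E1, E2, Er, E3.
    transitivity (al * P * (C * C * (si * si + c * c) + kappa * (S * S) * (kappa * kappa))
                  + n4 * Z); [| ring].
    rewrite hkk, Hcs, !Rmult_1_r, HCS. ring. }
  set (sigma := n4 * P - al * Z).
  assert (E4 : n4 = sigma * P).
  { unfold sigma. replace n4 with (n4 * (P * P + Z * Z)) at 1 by (rewrite HPZ; ring).
    replace (n4 * (P * P + Z * Z)) with ((n4 * P - al * Z) * P + Z * (al * P + n4 * Z)) by ring.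
    rewrite HO. ring. }
  assert (E5 : al = - sigma * Z).
  { unfold sigma. replace al with (al * (P * P + Z * Z)) at 1 by (rewrite HPZ; ring).
    replace (al * (P * P + Z * Z)) with (- (n4 * P - al * Z) * Z + P * (al * P + n4 * Z)) by ring.
    rewrite HO. ring. }
  split.
  - transitivity ((al * al + n4 * n4) * (P * P + Z * Z) - (al * P + n4 * Z) * (al * P + n4 * Z));
      [unfold sigma; ring | rewrite HU, HPZ, HO; ring].
  - clearbody sigma. f_equal.
    + rewrite E1, Er, E5. ring.
    + rewrite E2, Er, E5. ring.
    + rewrite E3, E5. ring.
    + exact E4.
Qed.

(** Subtracting the values at 1 and -1 isolates the coefficient of [lam] in the
    characteristic polynomial. *)
Lemma mean_curvature_trace (E F G e f g k1 k2 : R) :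
  (forall lam, (e - lam * E) * (g - lam * G) - (f - lam * F) * (f - lam * F)
     = (E * G - F * F) * ((lam - k1) * (lam - k2))) ->
  (E * G - F * F) * (k1 + k2) = e * G + g * E - 2 * (f * F).
Proof.
  intros H. pose proof (H 1) as h1. pose proof (H (-1)) as h2. lra.
Qed.

(** The normal is [sigma] times [(- z', x')] in the plane of the profile curve, with
    [sigma] constant by continuity.  The principal curvatures are then
    [sigma k] along the profile and [sigma z' ct(x)] along the parallel. *)
Lemma profile_equation kappa H L x z N :
  model kappa -> unit_speed L x z -> (forall s, 0 < s < L -> off_axis kappa (x s)) ->
  H_surface kappa H (fun s _ => 0 < s < L) (rotate kappa x z) N ->
  exists sigma, sigma * sigma = 1 /\
    (forall s t, 0 < s < L -> c4 (N s t) = sigma * Derive x s) /\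
    forall s, 0 < s < L ->
      Derive x s * Derive (Derive z) s - Derive z s * Derive (Derive x) s
      = 2 * (sigma * H (sigma * Derive x s)) - Derive z s * ct kappa (x s).
Proof.
  intros hk Hu Ho [Himm Hmean].
  assert (HC2 := profile_C2 kappa L x z hk Hu (imm_C2 _ _ _ _ Himm)).
  assert (hkk : kappa * kappa = 1) by (destruct hk; subst; ring).
  set (sg := fun s t => c4 (N s t) * Derive x s
     - (cn kappa (x s) * (c1 (N s t) * cos t + c2 (N s t) * sin t)
        - sn kappa (x s) * c3 (N s t)) * Derive z s).
  assert (Hform : forall s t, 0 < s < L -> sg s t * sg s t = 1 /\
    N s t = Vec4 (- sg s t * Derive z s * cn kappa (x s) * cos t)
      (- sg s t * Derive z s * cn kappa (x s) * sin t)
      (kappa * sg s t * Derive z s * sn kappa (x s)) (sg s t * Derive x s)).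
  { intros s t Hs. destruct (Hu s Hs) as [Hx [Hz H1]]. apply Derive_correct in Hx, Hz.
    apply (normal_form kappa x z); try assumption.
    - apply sn_pos; [exact hk | apply Ho, Hs].
    - rewrite <- H1. ring.
    - apply (nrm_tangent _ _ _ _ Himm), Hs.
    - apply (nrm_unit _ _ _ _ Himm), Hs.
    - rewrite <- (rotate_d1 kappa x z s t _ _ hk Hx Hz). apply (nrm_orth1 _ _ _ _ Himm), Hs.
    - rewrite <- (rotate_d2 kappa x z s t). apply (nrm_orth2 _ _ _ _ Himm), Hs. }
  assert (Hpm : forall s t, 0 < s < L -> sg s t = 1 \/ sg s t = -1).
  { intros s t Hs. destruct (Hform s t Hs) as [h _].
    assert (hh : (sg s t - 1) * (sg s t + 1) = 0) by lra.
    apply Rmult_integral in hh. destruct hh; [left | right]; lra. }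
  assert (Hcx : forall s, 0 < s < L -> continuous x s).
  { intros s Hs. apply (ex_derive_continuous (V := R_NormedModule)), (Hu s Hs). }
  assert (Hs_cont : forall t s, 0 < s < L -> continuous (fun s => sg s t) s).
  { intros t s Hs. destruct (nrm_cont _ _ _ _ Himm s t Hs) as [[m1 _] [[m2 _] [[m3 _] [m4 _]]]].
    apply continuity_2d_slice1 in m1, m2, m3, m4.
    destruct (HC2 s Hs) as [Hx2 Hz2].
    apply (ex_derive_continuous (V := R_NormedModule)) in Hx2, Hz2.
    apply (continuous_minus (fun s => c4 (N s t) * Derive x s)).
    { apply (continuous_mult (fun s => c4 (N s t))); assumption. }
    apply (continuous_mult (fun s => cn kappa (x s) * (c1 (N s t) * cos t + c2 (N s t) * sin t)
        - sn kappa (x s) * c3 (N s t)) (Derive z)); [| assumption].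
    apply (continuous_minus (fun s => cn kappa (x s) * (c1 (N s t) * cos t + c2 (N s t) * sin t))).
    - apply (continuous_mult (fun s => cn kappa (x s))
        (fun s => c1 (N s t) * cos t + c2 (N s t) * sin t)); [apply cn_continuous; auto |].
      apply (continuous_plus (fun s => c1 (N s t) * cos t));
        [apply (continuous_mult (fun s => c1 (N s t))) |
         apply (continuous_mult (fun s => c2 (N s t)))]; try assumption; apply continuous_const.
    - apply (continuous_mult (fun s => sn kappa (x s)));
        [apply sn_continuous; auto | assumption]. }
  assert (Ht_cont : forall s t, 0 < s < L -> continuous (fun t => sg s t) t).
  { intros s t Hs. destruct (nrm_cont _ _ _ _ Himm s t Hs) as [[m1 _] [[m2 _] [[m3 _] [m4 _]]]].
    apply continuity_2d_slice2 in m1, m2, m3, m4.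
    apply (continuous_minus (fun t => c4 (N s t) * Derive x s)).
    { apply (continuous_mult (fun t => c4 (N s t))); [assumption | apply continuous_const]. }
    apply (continuous_mult (fun t => cn kappa (x s) * (c1 (N s t) * cos t + c2 (N s t) * sin t)
        - sn kappa (x s) * c3 (N s t)) (fun _ => Derive z s)); [| apply continuous_const].
    apply (continuous_minus (fun t => cn kappa (x s) * (c1 (N s t) * cos t + c2 (N s t) * sin t))).
    - apply (continuous_mult (fun _ => cn kappa (x s))
        (fun t => c1 (N s t) * cos t + c2 (N s t) * sin t)); [apply continuous_const |].
      apply (continuous_plus (fun t => c1 (N s t) * cos t));
        [apply (continuous_mult (fun t => c1 (N s t))) |
         apply (continuous_mult (fun t => c2 (N s t)))]; try assumption.
      + apply continuous_cos.
      + apply continuous_sin.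
    - apply (continuous_mult (fun _ => sn kappa (x s))); [apply continuous_const | assumption]. }
  destruct (Rlt_or_le 0 L) as [HL | HL].
  2: { exists 1. split; [ring | split; intros; lra]. }
  set (sigma := sg (L / 2) 0).
  assert (Hsig : forall s t, 0 < s < L -> sg s t = sigma).
  { intros s t Hs. unfold sigma. transitivity (sg s 0).
    - apply (sign_constant (fun t => sg s t) (- Rabs t - 1) (Rabs t + 1)).
      + intros y _. apply Ht_cont, Hs.
      + intros y _. apply Hpm, Hs.
      + pose proof (Rle_abs t). pose proof (Rle_abs (- t)). rewrite Rabs_Ropp in *. lra.
      + pose proof (Rabs_pos t). lra.
    - apply (sign_constant (fun s => sg s 0) 0 L); try lra.
      + intros y Hy. apply Hs_cont, Hy.
      + intros y Hy. apply Hpm, Hy. }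
  exists sigma. split; [apply Hform; lra | split].
  - intros s t Hs. destruct (Hform s t Hs) as [_ ->]. rewrite Hsig by exact Hs. reflexivity.
  - intros s Hs. destruct (Hmean s 0 Hs) as [k1 [k2 [Hpc Hh]]].
    destruct (Hu s Hs) as [Hx [Hz H1]]. apply Derive_correct in Hx, Hz.
    destruct (HC2 s Hs) as [Hx2 Hz2].
    pose proof (sn_pos kappa _ hk (Ho s Hs)) as HS.
    pose proof (cn_sn_square kappa (x s) hk) as HCS.
    destruct (Hform s 0 Hs) as [Hsq HN]. rewrite Hsig in Hsq, HN by exact Hs.
    apply mean_curvature_trace in Hpc.
    rewrite (rotate_d11 kappa L x z s 0 hk Hu Hs Hx2) in Hpc.
    rewrite (rotate_d12 kappa x z s 0 _ hk Hx), rotate_d22 in Hpc.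
    rewrite (rotate_d1 kappa x z s 0 _ _ hk Hx Hz), rotate_d2 in Hpc.
    unfold angle in Hh. rewrite HN in Hpc, Hh.
    unfold dot, dz in Hpc, Hh. simpl in Hpc, Hh. rewrite cos_0, sin_0 in Hpc, Hh.
    unfold ct.
    set (S := sn kappa (x s)) in *. set (C := cn kappa (x s)) in *.
    set (P := Derive x s) in *. set (Z := Derive z s) in *.
    set (P' := Derive (Derive x) s) in *. set (Z' := Derive (Derive z) s) in *.
    clearbody S C P Z P' Z' sigma.
    assert (HPZ : P * P + Z * Z = 1) by lra.
    assert (Htr : (S * S) * (k1 + k2)
              = (sigma * (P * Z' - Z * P')) * (S * S) + sigma * Z * S * C).
    { transitivity ((P * P * (C * C + kappa * kappa * (kappa * (S * S))) + Z * Z)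
                    * (S * S) * (k1 + k2)); [rewrite hkk, Rmult_1_l, HCS, Rmult_1_r, HPZ; ring |].
      transitivity ((sigma * (P * Z' - Z * P' * (C * C + kappa * kappa * (kappa * (S * S)))
          + (kappa - kappa * (kappa * kappa)) * (C * S * (P * P) * Z))) * (S * S)
          + sigma * Z * S * C * (P * P * (C * C + kappa * kappa * (kappa * (S * S))) + Z * Z));
        [| rewrite hkk, Rmult_1_l, HCS, !Rmult_1_r, HPZ; ring].
      etransitivity; [| etransitivity; [exact Hpc |]]; ring. }
    assert (Hh' : k1 + k2 = 2 * H (sigma * P)).
    { replace (sigma * P) with (- sigma * Z * C * 1 * 0 + - sigma * Z * C * 0 * 0
        + kappa * (kappa * sigma * Z * S * 0) + sigma * P * 1) by ring.
      rewrite Hh. field. }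
    rewrite Hh' in Htr.
    assert (Hdiv : 2 * H (sigma * P) = sigma * (P * Z' - Z * P') + sigma * Z * (C / S)).
    { apply (Rmult_eq_reg_l (S * S)); [| nra]. rewrite Htr. field. lra. }
    transitivity (sigma * sigma * (P * Z' - Z * P')); [rewrite Hsq; ring |].
    transitivity (sigma * (2 * H (sigma * P)) - sigma * sigma * (Z * (C / S)));
      [rewrite Hdiv; ring | rewrite Hsq; ring].
Qed.

(** * Regularity of the profile at the poles *)

(** The two points [(s,0)] and [(-s,0)] of the disc lie on the same parallel, so the
    height is even along the first axis and its derivative vanishes at 0. *)
Lemma pole_height kappa H L x z N :
  closes_up kappa H L (rotate kappa x z) N ->
  filterlim (Derive z) (at_right 0) (locally 0).
Proof.
  intros [eps [Y [M [Heps [[Himm _] Hpolar]]]]].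
  set (g := fun u => c4 (Y u 0)).
  assert (Hg : forall s, 0 <= s < eps -> g s = z s /\ g (- s) = z s).
  { intros s Hs. destruct (Hpolar s 0 Hs) as [h0 _]. destruct (Hpolar s PI Hs) as [h1 _].
    rewrite cos_0, sin_0, Rmult_1_r, Rmult_0_r in h0.
    rewrite cos_PI, sin_PI, Rmult_0_r in h1.
    replace (s * -1) with (- s) in h1 by ring.
    unfold g. rewrite h0, h1. split; reflexivity. }
  assert (Heven : forall u, - eps < u < eps -> g (- u) = g u).
  { intros u Hu. destruct (Rle_or_lt 0 u) as [h | h].
    - destruct (Hg u ltac:(lra)) as [-> ->]. reflexivity.
    - destruct (Hg (- u) ltac:(lra)) as [h1 h2]. rewrite Ropp_involutive in h2. congruence. }
  destruct (imm_C2 _ _ _ _ Himm 0 0) as [_ [_ [_ [_ [Hd [_ [[Hc _] _]]]]]]]; [nra |].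
  change (ex_derive g 0) in Hd.
  apply continuity_2d_slice1 in Hc. change (continuous (Derive g) 0) in Hc.
  (* an even differentiable function is critical at 0 *)
  assert (Hg0 : Derive g 0 = 0).
  { assert (h : is_derive g 0 (- Derive g 0)); [| apply is_derive_unique in h; lra].
    apply (is_derive_ext_loc (fun u => g (0 - u))).
    - apply (locally_interval (- eps) eps); [lra |]. intros u Hu.
      rewrite Rminus_0_l. apply Heven, Hu.
    - apply is_derive_reverse. rewrite Rminus_0_r. apply Derive_correct, Hd. }
  apply at_right_intro. intros e He.
  destruct (continuous_near _ 0 e Hc He) as [d [Hd0 Hnear]].
  exists (Rmin d eps). split; [apply Rmin_glb_lt; lra |]. intros s Hs.
  pose proof (Rmin_l d eps). pose proof (Rmin_r d eps).
  specialize (Hnear s ltac:(rewrite Rabs_pos_eq; lra)). rewrite Hg0 in Hnear.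
  replace (Derive z s) with (Derive g s); [exact Hnear |].
  apply Derive_ext_loc, (locally_interval 0 eps); [lra |]. intros t Ht. apply Hg. lra.
Qed.

(** The third coordinate [cn(x)] is continuous at the pole, and [- kappa cn] is
    strictly increasing off the axis, so [cn(x) -> 1] forces [x -> 0]. *)
Lemma pole_distance kappa H L x z N :
  model kappa -> (forall s, 0 < s < L -> off_axis kappa (x s)) -> x 0 = 0 ->
  closes_up kappa H L (rotate kappa x z) N ->
  filterlim x (at_right 0) (locally 0).
Proof.
  intros hk Ho Hx0 [eps [Y [M [Heps [[Himm _] Hpolar]]]]].
  set (h := fun u => c3 (Y u 0)).
  assert (Hh : forall s, 0 <= s < eps -> h s = cn kappa (x s)).
  { intros s Hs. destruct (Hpolar s 0 Hs) as [h0 _].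
    rewrite cos_0, sin_0, Rmult_1_r, Rmult_0_r in h0. unfold h. rewrite h0. reflexivity. }
  destruct (imm_C2 _ _ _ _ Himm 0 0) as [_ [_ [[Hc _] _]]]; [nra |].
  apply continuity_2d_slice1 in Hc. change (continuous h 0) in Hc.
  assert (Hmono : forall a b, 0 <= a -> a < b -> off_axis kappa b ->
            - kappa * cn kappa a < - kappa * cn kappa b).
  { intros a b Ha Hab Hb.
    assert (Hd : forall y, is_derive (fun y => - kappa * cn kappa y) y (sn kappa y)).
    { intros y.
      apply (is_derive_eq _ _ _ _ (is_derive_scal _ y (- kappa) _ (cn_derive kappa y hk))).
      unfold scal; simpl; unfold mult; simpl.
      transitivity (kappa * kappa * sn kappa y); [ring | destruct hk; subst; ring]. }
    apply (increasing_of_derive (fun y => - kappa * cn kappa y) (sn kappa) 0 b); try lra.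
    - intros y _. exact (continuous_of_derive _ _ _ (Hd y)).
    - intros y _. apply Hd.
    - intros y Hy. apply sn_pos; [exact hk |].
      destruct Hb as [_ Hb]. split; [lra |]. intros hh. specialize (Hb hh). lra. }
  apply at_right_intro. intros e He.
  set (e' := Rmin e 1).
  assert (He' : 0 < e' <= e /\ e' <= 1).
  { unfold e'. apply Rmin_case_strong; intros; lra. }
  assert (Ho' : off_axis kappa e').
  { split; [lra | intros _]. pose proof PI2_1. lra. }
  pose proof (Hmono 0 e' ltac:(lra) ltac:(lra) Ho') as Hgap. rewrite cn_0 in Hgap by exact hk.
  destruct (continuous_near h 0 (- kappa * cn kappa e' - - kappa * 1) Hc ltac:(lra))
    as [d [Hd Hnear]].
  exists (Rmin d eps). split; [apply Rmin_glb_lt; lra |]. intros s Hs.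
  pose proof (Rmin_l d eps). pose proof (Rmin_r d eps).
  specialize (Hnear s ltac:(rewrite Rabs_pos_eq; lra)).
  rewrite !Hh, Hx0, cn_0 in Hnear by (exact hk || lra).
  assert (Hos : off_axis kappa (x s)) by (apply Ho; lra).
  pose proof (proj1 Hos) as Hpos.
  rewrite Rminus_0_r, Rabs_pos_eq by lra.
  destruct (Rlt_or_le (x s) e') as [hx | hx]; [lra | exfalso].
  assert (- kappa * cn kappa e' <= - kappa * cn kappa (x s)).
  { destruct (Rle_lt_or_eq_dec _ _ hx) as [hh | hh]; [| rewrite hh; lra].
    left. apply Hmono; [lra | exact hh | exact Hos]. }
  apply Rabs_def2 in Hnear. destruct hk; subst kappa; lra.
Qed.

(** From [x'^2 = 1 - z'^2] the limit of [x'] is 1 or -1, and [x] leaves the value 0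
    through positive values. *)
Lemma pole_speed kappa L x z :
  0 < L -> unit_speed L x z -> (forall s, 0 < s < L -> off_axis kappa (x s)) ->
  (forall s, 0 < s < L -> continuous (Derive x) s) ->
  filterlim x (at_right 0) (locally 0) ->
  filterlim (Derive z) (at_right 0) (locally 0) ->
  filterlim (Derive x) (at_right 0) (locally 1).
Proof.
  intros HL Hu Ho Hc Hx Hz.
  destruct (at_right_elim _ _ _ (1 / 2) Hz ltac:(lra)) as [d0 [Hd0 Hz0]].
  set (d := Rmin d0 L).
  assert (Hd : 0 < d /\ d <= d0 /\ d <= L).
  { unfold d. apply Rmin_case_strong; intros; lra. }
  assert (Hne : forall s, 0 < s < d -> Derive x s <> 0).
  { intros s Hs h. destruct (Hu s ltac:(lra)) as [_ [_ h1]]. rewrite h in h1.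
    specialize (Hz0 s ltac:(lra)). rewrite Rminus_0_r in Hz0. apply Rabs_def2 in Hz0. nra. }
  assert (Hpos : forall s, 0 < s < d -> 0 < Derive x s).
  { intros s Hs. destruct (Rtotal_order (Derive x s) 0) as [h | [h | h]];
      [exfalso | exfalso; exact (Hne s Hs h) | exact h].
    (* otherwise x would decrease to a positive value while starting from 0 *)
    assert (Hneg : forall t, 0 < t <= s -> Derive x t < 0).
    { intros t Ht. apply (constant_sign (Derive x) t s) with (e := s); try lra.
      - intros y Hy. apply Hc. lra.
      - intros y Hy. apply Hne. lra. }
    assert (Hdecr : forall t, 0 < t < s -> x s < x t).
    { intros t Ht. apply (decreasing_of_derive x (Derive x) t s); try lra.
      - intros y Hy. apply (ex_derive_continuous (V := R_NormedModule)), (Hu y). lra.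
      - intros y Hy. apply Derive_correct, (Hu y). lra.
      - intros y Hy. apply Hneg. lra. }
    pose proof (proj1 (Ho s ltac:(lra))) as Hxs.
    destruct (at_right_elim _ _ _ (x s) Hx Hxs) as [d1 [Hd1 H1]].
    set (t := Rmin (d1 / 2) (s / 2)).
    assert (Ht : 0 < t < s /\ t < d1) by (unfold t; apply Rmin_case_strong; intros; lra).
    specialize (H1 t ltac:(lra)). specialize (Hdecr t ltac:(lra)).
    rewrite Rminus_0_r in H1. apply Rabs_def2 in H1. lra. }
  apply at_right_intro. intros e He.
  destruct (at_right_elim _ _ _ e Hz He) as [d1 [Hd1 H1]].
  exists (Rmin d d1). split; [apply Rmin_glb_lt; lra |]. intros s Hs.
  pose proof (Rmin_l d d1). pose proof (Rmin_r d d1).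
  specialize (H1 s ltac:(lra)). specialize (Hpos s ltac:(lra)).
  specialize (Hz0 s ltac:(lra)).
  destruct (Hu s ltac:(lra)) as [_ [_ h1]].
  rewrite Rminus_0_r in H1, Hz0. rewrite Rabs_minus_sym.
  pose proof (Rabs_square (Derive z s)) as h2. pose proof (Rabs_pos (Derive z s)).
  assert (Derive x s <= 1) by nra.
  rewrite Rabs_pos_eq by lra. nra.
Qed.

Lemma pole_angle kappa H L X N f l t :
  closes_up kappa H L X N ->
  (forall s, 0 < s < L -> c4 (N s t) = f s) ->
  filterlim f (at_right 0) (locally l) -> c4 (N 0 t) = l.
Proof.
  intros [eps [Y [M [Heps [[Himm _] Hpolar]]]]] Hf Hl.
  destruct (nrm_cont _ _ _ _ Himm 0 0) as [_ [_ [_ [Hc _]]]]; [nra |].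
  assert (H0 : c4 (M 0 0) = c4 (N 0 t)).
  { destruct (Hpolar 0 t ltac:(lra)) as [_ h]. rewrite !Rmult_0_l in h. rewrite h. reflexivity. }
  destruct (Req_dec (c4 (N 0 t)) l) as [h | h]; [exact h | exfalso].
  set (e := Rabs (c4 (N 0 t) - l) / 2).
  assert (He : 0 < e) by (unfold e; pose proof (Rabs_pos_lt (c4 (N 0 t) - l) ltac:(lra)); lra).
  destruct (at_right_elim _ _ _ e Hl He) as [d1 [Hd1 H1]].
  destruct (Hc (mkposreal e He)) as [d2 H2]. simpl in H2.
  set (s := Rmin (d1 / 2) (Rmin (d2 / 2) (eps / 2))).
  pose proof (cond_pos d2) as Hd2.
  assert (Hs : 0 < s < eps /\ s < d1 /\ s < d2).
  { unfold s. repeat apply Rmin_case_strong; intros; lra. }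
  specialize (H1 s ltac:(lra)).
  assert (Hle : forall y, -1 <= y <= 1 -> Rabs (s * y - 0) < d2).
  { intros y Hy. rewrite Rminus_0_r, Rabs_mult, (Rabs_pos_eq s) by lra.
    apply Rabs_between in Hy. pose proof (Rabs_pos y). nra. }
  specialize (H2 (s * cos t) (s * sin t) (Hle _ (COS_bound t)) (Hle _ (SIN_bound t))).
  destruct (Hpolar s t ltac:(lra)) as [_ h2]. rewrite h2, Hf, H0 in H2 by lra.
  assert (Rabs (c4 (N 0 t) - l) < 2 * e); [| unfold e in *; lra].
  replace (c4 (N 0 t) - l) with ((f s - l) + - (f s - c4 (N 0 t))) by ring.
  eapply Rle_lt_trans; [apply Rabs_triang |]. rewrite Rabs_Ropp. lra.
Qed.

(** * Monotonicity of the angle function *)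

Lemma C1_rescale G c : class_C1 G -> class_C1 (fun y => c * G (c * y)).
Proof.
  intros hG.
  assert (Hd : forall y, is_derive (fun y => c * G (c * y)) y (c * (c * Derive G (c * y)))).
  { intros y. apply (is_derive_scal (fun y => G (c * y)) y c).
    apply (is_derive_comp G (fun y => c * y)); [apply Derive_correct, hG |].
    auto_derive; [exact I | ring]. }
  intros y. split; [eexists; apply Hd |].
  apply (continuous_ext (fun y => c * (c * Derive G (c * y)))).
  - intros t. symmetry. apply is_derive_unique, Hd.
  - apply (continuous_mult (fun _ => c)); [apply continuous_const |].
    apply (continuous_mult (fun _ => c)); [apply continuous_const |].
    apply (continuous_comp (fun y => c * y) (Derive G)); [| apply hG].
    apply (continuous_mult (fun _ => c)); [apply continuous_const | apply continuous_id].
Qed.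

Lemma unit_speed_reverse L x z :
  unit_speed L x z -> unit_speed L (fun s => x (L - s)) (fun s => z (L - s)).
Proof.
  intros Hu s Hs. destruct (Hu (L - s) ltac:(lra)) as [Hx [Hz h]].
  apply Derive_correct in Hx, Hz.
  pose proof (is_derive_reverse _ _ _ _ Hx) as Hx'.
  pose proof (is_derive_reverse _ _ _ _ Hz) as Hz'.
  split; [eexists; exact Hx' | split; [eexists; exact Hz' |]].
  replace (Derive (fun s => x (L - s)) s) with (- Derive x (L - s))
    by (symmetry; apply is_derive_unique, Hx').
  replace (Derive (fun s => z (L - s)) s) with (- Derive z (L - s))
    by (symmetry; apply is_derive_unique, Hz').
  rewrite <- h. ring.
Qed.

Lemma Derive_reverse f L s :
  ex_derive f (L - s) -> Derive (fun s => f (L - s)) s = - Derive f (L - s).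
Proof.
  intros Hf. apply is_derive_unique, is_derive_reverse, Derive_correct, Hf.
Qed.

Lemma filterlim_opp_right (f g : R -> R) L l :
  0 < L -> filterlim f (at_right 0) (locally l) -> (forall s, 0 < s < L -> f s = - g s) ->
  filterlim g (at_right 0) (locally (- l)).
Proof.
  intros HL Hf Hfg. apply at_right_intro. intros e He.
  destruct (at_right_elim _ _ _ e Hf He) as [d [Hd H]].
  exists (Rmin d L). split; [apply Rmin_glb_lt; lra |]. intros s Hs.
  pose proof (Rmin_l d L). pose proof (Rmin_r d L).
  specialize (H s ltac:(lra)). rewrite Hfg in H by lra.
  replace (g s - - l) with (- (- g s - l)) by ring. rewrite Rabs_Ropp. exact H.
Qed.

(** In terms of [k = x' z'' - z' x''], orthogonality of the tangent and its derivative
    gives [x'' = - z' k] and [z'' = x' k]. *)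
Lemma speed_derivatives G kappa L x z :
  unit_speed L x z ->
  (forall s, 0 < s < L -> ex_derive (Derive x) s /\ ex_derive (Derive z) s) ->
  (forall s, 0 < s < L ->
     Derive x s * Derive (Derive z) s - Derive z s * Derive (Derive x) s
     = curv kappa G (x s) (Derive x s) (Derive z s)) ->
  forall s, 0 < s < L ->
    is_derive (Derive x) s (- (Derive z s * curv kappa G (x s) (Derive x s) (Derive z s))) /\
    is_derive (Derive z) s (Derive x s * curv kappa G (x s) (Derive x s) (Derive z s)).
Proof.
  intros Hu HC2 Hk s Hs. destruct (HC2 s Hs) as [Hx2 Hz2].
  apply Derive_correct in Hx2, Hz2.
  destruct (Hu s Hs) as [_ [_ H1]].
  (* differentiate x'^2 + z'^2 = 1 *)
  assert (H0 : 2 * (Derive x s * Derive (Derive x) s + Derive z s * Derive (Derive z) s) = 0).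
  { transitivity (Derive (fun _ : R => 1) s); [symmetry | apply Derive_const].
    apply is_derive_unique.
    apply (is_derive_ext_loc (fun s => Derive x s * Derive x s + Derive z s * Derive z s)).
    - apply (locally_interval 0 L); [exact Hs |]. intros t Ht.
      destruct (Hu t Ht) as [_ [_ <-]]. simpl. change (@eq R
        (Derive x t * Derive x t + Derive z t * Derive z t)
        (Derive x t * (Derive x t * 1) + Derive z t * (Derive z t * 1))). ring.
    - apply (is_derive_eq _ _ _ _ (is_derive_plus _ _ _ _ _
        (is_derive_mult _ _ _ _ _ Hx2 Hx2 Rmult_comm)
        (is_derive_mult _ _ _ _ _ Hz2 Hz2 Rmult_comm))).
      unfold plus, mult; simpl. ring. }
  rewrite <- (Hk s Hs).
  set (P := Derive x s) in *. set (Z := Derive z s) in *.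
  split; [apply (is_derive_eq _ _ _ _ Hx2) | apply (is_derive_eq _ _ _ _ Hz2)].
  - set (P' := Derive (Derive x) s) in *. set (Z' := Derive (Derive z) s) in *.
    transitivity ((P ^ 2 + Z ^ 2) * P' - P * (P * P' + Z * Z')); [| ring].
    replace (P * P' + Z * Z') with 0 by lra. rewrite H1. ring.
  - set (P' := Derive (Derive x) s) in *. set (Z' := Derive (Derive z) s) in *.
    transitivity ((P ^ 2 + Z ^ 2) * Z' - Z * (P * P' + Z * Z')); [| ring].
    replace (P * P' + Z * Z') with 0 by lra. rewrite H1. ring.
Qed.

Lemma extended_profile kappa G L x z :
  0 < L -> unit_speed L x z -> (forall s, 0 < s < L -> off_axis kappa (x s)) ->
  (forall s, 0 < s < L -> ex_derive (Derive x) s /\ ex_derive (Derive z) s) ->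
  (forall s, 0 < s < L ->
     Derive x s * Derive (Derive z) s - Derive z s * Derive (Derive x) s
     = curv kappa G (x s) (Derive x s) (Derive z s)) ->
  filterlim x (at_right 0) (locally 0) -> filterlim x (at_left L) (locally 0) ->
  filterlim (Derive x) (at_right 0) (locally 1) ->
  filterlim (Derive x) (at_left L) (locally (-1)) ->
  filterlim (Derive z) (at_right 0) (locally 0) ->
  filterlim (Derive z) (at_left L) (locally 0) ->
  exists xe pe qe, pole_to_pole kappa G L xe pe qe /\
    forall s, 0 < s < L -> pe s = Derive x s.
Proof.
  intros HL Hu Ho HC2 Hk lx0 lxL lp0 lpL lq0 lqL.
  pose proof (speed_derivatives G kappa L x z Hu HC2 Hk) as Hder.
  destruct (C0_extension_lt (T := R_UniformSpace) x 0 0 0 L HL) as [xe [cx [ex [x0 xL]]]];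
    try assumption.
  { intros s Hs. apply (ex_derive_continuous (V := R_NormedModule)), (Hu s Hs). }
  destruct (C0_extension_lt (T := R_UniformSpace) (Derive x) 1 (-1) 0 L HL)
    as [pe [cp [ep [p0 pL]]]]; try assumption.
  { intros s Hs. exact (continuous_of_derive _ _ _ (proj1 (Hder s Hs))). }
  destruct (C0_extension_lt (T := R_UniformSpace) (Derive z) 0 0 0 L HL)
    as [qe [cq [eq [q0 qL]]]]; try assumption.
  { intros s Hs. exact (continuous_of_derive _ _ _ (proj2 (Hder s Hs))). }
  exists xe, pe, qe. split; [| exact ep].
  assert (Hloc : forall (f fe : R -> R), (forall s, 0 < s < L -> fe s = f s) ->
    forall s l, 0 < s < L -> is_derive f s l -> is_derive fe s l).
  { intros f fe Hfe s l Hs. apply is_derive_ext_loc.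
    apply (locally_interval 0 L); [exact Hs |]. intros t Ht. symmetry. apply Hfe, Ht. }
  split; try assumption; try (split; [| split]; assumption).
  split; intros s Hs; rewrite ?(ex s Hs), ?(ep s Hs), ?(eq s Hs).
  - apply (Hloc x xe ex s _ Hs), Derive_correct, (Hu s Hs).
  - apply (Hloc (Derive x) pe ep s _ Hs), (Hder s Hs).
  - apply (Hloc (Derive z) qe eq s _ Hs), (Hder s Hs).
  - destruct (Hu s Hs) as [_ [_ <-]]. ring.
  - apply Ho, Hs.
Qed.

(** The tangent of a slice is horizontal, so [x'] only takes the values 1 and -1. *)
Lemma horizontal_speed_constant L x z :
  0 < L -> unit_speed L x z -> (forall s, 0 < s < L -> continuous (Derive x) s) ->
  (forall s, 0 <= s <= L -> z s = z 0) ->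
  exists p0, forall s, 0 < s < L -> Derive x s = p0.
Proof.
  intros HL Hu Hc Hz.
  assert (Hpm : forall s, 0 < s < L -> Derive x s = 1 \/ Derive x s = -1).
  { intros s Hs. destruct (Hu s Hs) as [_ [_ h]].
    assert (Hz0 : Derive z s = 0).
    { transitivity (Derive (fun _ : R => z 0) s); [| apply Derive_const].
      apply Derive_ext_loc, (locally_interval 0 L); [exact Hs |]. intros t Ht. apply Hz. lra. }
    rewrite Hz0 in h.
    assert (hh : (Derive x s - 1) * (Derive x s + 1) = 0) by lra.
    apply Rmult_integral in hh. destruct hh; [left | right]; lra. }
  exists (Derive x (L / 2)). intros s Hs.
  exact (sign_constant (Derive x) 0 L Hc Hpm s (L / 2) Hs ltac:(lra)).
Qed.

Theorem theorem3p9 (kappa : R) (H : R -> R) (L : R) (x z : R -> R)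
    (N : R -> R -> vec4)
    (hkappa : kappa = -1 \/ kappa = 1)
    (hH : C1_on_pm1 H)
    (hH0 : isolated_zeros_of_finite_multiplicity H)
    (hS : rotational_H_sphere kappa H L x z N) :
  exists nu : R -> R,
    (forall s t, 0 <= s <= L -> angle kappa (N s t) = nu s) /\
    monotone_on 0 L nu.
Proof.
  destruct hS as [HL Hu Ho Hx0 HxL HS Hcap0 HcapL].
  destruct hH as [G [HGH hG]].
  change (unit_speed L x z) in Hu.
  destruct (profile_equation kappa H L x z N hkappa Hu Ho HS) as [sigma [Hsq [HN Heq]]].
  pose proof (profile_C2 kappa L x z hkappa Hu (imm_C2 _ _ _ _ (proj1 HS))) as HC2.
  assert (Hcp : forall s, 0 < s < L -> continuous (Derive x) s).
  { intros s Hs. apply (ex_derive_continuous (V := R_NormedModule)), (HC2 s Hs). }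
  assert (Hang : forall s t, angle kappa (N s t) = c4 (N s t)).
  { intros s t. unfold angle, dot, dz. simpl. ring. }
  assert (HNL : forall s t, 0 < s < L -> c4 (N (L - s) t) = sigma * Derive x (L - s)).
  { intros s t Hs. apply HN. lra. }
  (* what remains is a monotone extension of [sigma x'] with the values of the normal
     at the poles *)
  assert (Hfin : forall nu : R -> R, (forall s, 0 < s < L -> nu s = sigma * Derive x s) ->
    (forall t, c4 (N 0 t) = nu 0) -> (forall t, c4 (N L t) = nu L) -> monotone_on 0 L nu ->
    exists nu : R -> R, (forall s t, 0 <= s <= L -> angle kappa (N s t) = nu s) /\
      monotone_on 0 L nu).
  { intros nu Hin H0 HL' Hmon. exists nu. split; [| exact Hmon]. intros s t Hs. rewrite Hang.
    destruct (Req_dec s 0) as [-> | h0]; [apply H0 |].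
    destruct (Req_dec s L) as [-> | hL]; [apply HL' |].
    rewrite Hin by lra. apply HN. lra. }
  destruct HxL as [HxL | [_ [_ Hz]]].
  - set (Gs := fun y => sigma * G (sigma * y)).
    assert (Hk : forall s, 0 < s < L ->
      Derive x s * Derive (Derive z) s - Derive z s * Derive (Derive x) s
      = curv kappa Gs (x s) (Derive x s) (Derive z s)).
    { intros s Hs. rewrite (Heq s Hs). unfold curv, Gs. rewrite HGH; [reflexivity |].
      destruct (Hu s Hs) as [_ [_ h]].
      assert (-1 <= Derive x s <= 1) by nra.
      assert (hs : (sigma - 1) * (sigma + 1) = 0) by lra.
      apply Rmult_integral in hs. destruct hs as [hs | hs].
      - replace sigma with 1 by lra. lra.
      - replace sigma with (-1) by lra. lra. }
    pose proof (unit_speed_reverse L x z Hu) as Hur.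
    assert (Hor : forall s, 0 < s < L -> off_axis kappa (x (L - s))) by (intros; apply Ho; lra).
    assert (Hdx : forall s, 0 < s < L -> Derive (fun s => x (L - s)) s = - Derive x (L - s)).
    { intros s Hs. apply Derive_reverse, (Hu (L - s)). lra. }
    assert (Hdz : forall s, 0 < s < L -> Derive (fun s => z (L - s)) s = - Derive z (L - s)).
    { intros s Hs. apply Derive_reverse, (Hu (L - s)). lra. }
    pose proof (pole_distance _ _ _ _ _ _ hkappa Ho Hx0 Hcap0) as lx0.
    pose proof (pole_height _ _ _ _ _ _ Hcap0) as lq0.
    pose proof (pole_speed _ _ _ _ HL Hu Ho Hcp lx0 lq0) as lp0.
    assert (HxL' : x (L - 0) = 0) by (rewrite Rminus_0_r; exact HxL).
    pose proof (pole_distance kappa H L (fun s => x (L - s)) (fun s => z (L - s)) _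
      hkappa Hor HxL' HcapL) as lxL.
    pose proof (pole_height kappa H L (fun s => x (L - s)) (fun s => z (L - s)) _ HcapL) as lqL.
    assert (Hcpr : forall s, 0 < s < L -> continuous (Derive (fun s => x (L - s))) s).
    { intros s Hs. apply (continuous_ext_loc _ (fun s => - Derive x (L - s))).
      - apply (locally_interval 0 L); [exact Hs |]. intros t Ht. symmetry. apply Hdx, Ht.
      - apply (continuous_opp (fun s => Derive x (L - s))), continuous_reverse, Hcp. lra. }
    pose proof (pole_speed _ _ _ _ HL Hur Hor Hcpr lxL lqL) as lpL.
    apply (filterlim_opp_right _ (fun s => Derive x (L - s)) L) in lpL; [| exact HL | exact Hdx].
    apply (filterlim_opp_right _ (fun s => Derive z (L - s)) L) in lqL; [| exact HL | exact Hdz].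
    rewrite Ropp_0 in lqL.
    destruct (extended_profile kappa Gs L x z HL Hu Ho HC2 Hk lx0 (at_left_of_reverse _ _ _ lxL)
      lp0 (at_left_of_reverse _ _ _ lpL) lq0 (at_left_of_reverse _ _ _ lqL))
      as [xe [pe [qe [Hpp Hpe]]]].
    destruct (pp_first Hpp) as [_ [Hp0 _]]. destruct (pp_last Hpp) as [_ [HpL _]].
    pose proof (p_decreasing _ _ _ _ _ _ hkappa (C1_rescale G sigma hG) Hpp) as Hdec.
    assert (Hscal : forall (f : R -> R) l, filterlim f (at_right 0) (locally l) ->
      filterlim (fun s => sigma * f s) (at_right 0) (locally (sigma * l))).
    { intros f l Hf. exact (filterlim_comp _ _ _ f (fun y => sigma * y) _ _ _ Hf
        (filterlim_scal_r sigma l)). }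
    apply (Hfin (fun s => sigma * pe s)).
    + intros s Hs. rewrite Hpe by exact Hs. reflexivity.
    + intros t. rewrite Hp0.
      apply (pole_angle kappa H L _ N (fun s => sigma * Derive x s) _ t Hcap0);
        [intros; apply HN; assumption | apply Hscal, lp0].
    + intros t. rewrite HpL. pose proof (pole_angle kappa H L _ _
        (fun s => sigma * Derive x (L - s)) (sigma * -1) t HcapL) as h.
      cbv beta in h. rewrite Rminus_0_r in h. apply h.
      * intros; apply HNL; assumption.
      * exact (Hscal _ _ lpL).
    + assert (hs : (sigma - 1) * (sigma + 1) = 0) by lra.
      apply Rmult_integral in hs. destruct hs as [hs | hs]; [right | left];
        intros s1 s2 h1 h2 h3; specialize (Hdec s1 s2 h1 h2 h3).
      * replace sigma with 1 by lra. lra.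
      * replace sigma with (-1) by lra. lra.
  - destruct (horizontal_speed_constant L x z HL Hu Hcp Hz) as [p0 Hp0].
    assert (Hlim : filterlim (fun _ : R => sigma * p0) (at_right 0) (locally (sigma * p0)))
      by apply filterlim_const.
    apply (Hfin (fun _ => sigma * p0)).
    + intros s Hs. rewrite Hp0 by exact Hs. reflexivity.
    + intros t. apply (pole_angle kappa H L _ N (fun _ => sigma * p0) _ t Hcap0); [| exact Hlim].
      intros s Hs. rewrite HN, Hp0 by exact Hs. reflexivity.
    + intros t. pose proof (pole_angle kappa H L _ _ (fun _ => sigma * p0)
        (sigma * p0) t HcapL) as h.
      cbv beta in h. rewrite Rminus_0_r in h. apply h; [| exact Hlim].
      intros s Hs. rewrite HNL, Hp0 by lra. reflexivity.
    + left. intros; lra.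
Qed.
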